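(* Let $(X_i,Y_i)$, $i=1,\dots,n$, be independent observations satisfying $Y_i=\mathrm{tr}(X_i^\top A_0)+\xi_i$, where $A_0=(a_0(i,j))\in\mathbb R^{m_1\times m_2}$ is an unknown matrix and $\xi_1,\dots,\xi_n$ are i.i.d. zero-mean random variables with finite variance. Let the $X_i$ be i.i.d. with distribution $\Pi$ on $\mathcal X=\{e_j(m_1)e_k^\top(m_2):1\le j\le m_1,\ 1\le k\le m_2\}$. Set $m=m_1+m_2$, $M=m_1\vee m_2$. Suppose: 1. for some $r\ge1$ and $\alpha>1$, $\mathrm{rank}(A_0)\le r$ and $\rho(\Pi)\le \frac{\kappa_1(\Pi)^2}{11\,\alpha r}$; 2. there are constants $\sigma>0$, $\bar c>0$, $\beta\ge1$ and $\tilde c$ such that $\max_{i=1,\dots,n}\mathbb E\exp(|\xi_i|^\beta/\sigma^\beta)<\tilde c$ and $\mathbb E\xi_i^2\ge\bar c\,\sigma^2$ for all $1\le i\le n$; 3. there are constants $0<c_1\le c_1'<\infty$ such that $\sqrt{\frac{c_1}{m_1m_2}}\le\kappa_1(\Pi)\le\kappa_1'(\Pi)\le\sqrt{\frac{c_1'}{m_1m_2}}$, and in addition $2c_1'\le Mc_1$; 4. $\max_{i,j}|a_0(i,j)|\le a$ for some constant $a$; 5. $n>(m_1\vee m_2)\log^{1+2/\beta}(m)$. Let $$\lambda=C(\sigma\vee a)\sqrt{\frac{\log m}{(m_1\wedge m_2)n}},$$ where $C>0$ is a large enough constant that can depend only on $\alpha,\beta,\tilde c,\bar c,c_1,c_1'$.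 Then the estimator $$\hat A^{\lambda}=\mathrm{argmin}_{A\in\mathbb R^{m_1\times m_2}}\Big\{\|A\|_{L_2(\Pi)}^2-\Big\langle \frac2n\sum_{i=1}^nY_iX_i,\,A\Big\rangle+\lambda\|A\|_1\Big\}$$ satisfies, with probability at least $1-1/m$, $$\|\hat A^\lambda-A_0\|_\infty\le C'(\sigma\vee a)\sqrt{m_1m_2}\sqrt{\frac{M\log m}{n}},$$ where $C'>0$ can depend only on $\alpha,\beta,\tilde c,\bar c,c_1,c_1'$.
   Context: $e_k(m)$ denotes the $k$-th canonical basis vector of $\mathbb R^m$. $\langle A,B\rangle=\mathrm{tr}(A^\top B)$; $\|A\|_1,\|A\|_2,\|A\|_\infty$ are the nuclear, Frobenius and spectral norm, respectively. $x\vee y=\max(x,y)$, $x\wedge y=\min(x,y)$. For i.i.d. $X_i$ with distribution $\Pi$ (with $X\sim\Pi$), $$\langle A,B\rangle_{L_2(\Pi)}=\mathbb E\big(\langle A,X\rangle\langle B,X\rangle\big),\qquad \|A\|_{L_2(\Pi)}^2=\langle A,A\rangle_{L_2(\Pi)}.$$ $\kappa_1(\Pi)$ and $\kappa_1'(\Pi)$ are respectively the infimum and the supremum of $\|B\|_{L_2(\Pi)}$ over $B\in\mathbb R^{m_1\times m_2}$ with $\|B\|_2=1$ and $\mathrm{rank}(B)\le1$. The coherence is $$\rho(\Pi)=\sup\Big\{\frac{|\langle A,B\rangle_{L_2(\Pi)}|}{\|A\|_1\|B\|_1}: A,B\in\mathbb R^{m_1\times m_2}\ \text{nonzero},\ \langle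 A,B\rangle=0\Big\}.$$
   Formalization: The formal theorem additionally assumes that each noise variable ξ_i is independent of its design matrix X_i; without such a condition the statement fails, for example when ξ_i is a sign determined by the row of X_i. *)

(* Defs.v *)
From HB Require Import structures.
From mathcomp Require Import all_boot all_order all_algebra.
From mathcomp Require Import spectral complex.
From mathcomp Require Import all_classical all_reals all_analysis.

Set Implicit Arguments.
Unset Strict Implicit.
Unset Printing Implicit Defensive.

Import Order.TTheory GRing.Theory Num.Theory.
Import numFieldNormedType.Exports.

Local Open Scope classical_set_scope.
Local Open Scope ring_scope.

(* Matrices carry their Borel sigma-algebra, so that random matrices are
   random variables {RV P >-> 'M[R]_(m, n)}. *)
HB.instance Definition _ (R : realType) (m n : nat) :=
  Measurable.copy 'M[R]_(m, n) (g_sigma_algebraType (@open 'M[R]_(m, n))).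

Section MatrixNorms.
Context {R : realType} {m n : nat}.
Implicit Types A B : 'M[R]_(m, n).

Definition mxdot A B : R := \tr (A^T *m B).

Definition frobenius_norm A : R := Num.sqrt (mxdot A A).

(* The square roots of the eigenvalues of A^T A, with multiplicity and in no
   particular order. A^T A is real symmetric, hence normal over R[i], and then
   spectral_diag lists its (real, nonnegative) eigenvalues. When m < n, the
   list is the usual one padded with zeros. *)
Definition singular_value A (j : 'I_n) : R :=
  Num.sqrt (complex.Re
    (spectral_diag (map_mx (real_complex R) (A^T *m A)) 0 j)).

Definition nuclear_norm A : R := \sum_j singular_value A j.

Definition spectral_norm A : R := \big[Num.max/0]_j singular_value A j.

End MatrixNorms.

Section DesignDistribution.
Context {R : realType} {m1 m2 : nat}.
Variable Pi : probability 'M[R]_(m1, m2) R.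
Implicit Types A B : 'M[R]_(m1, m2).

Definition l2dot A B : R := fine 'E_Pi[(fun x => mxdot A x * mxdot B x)].

Definition l2norm A : R := Num.sqrt (l2dot A A).

Definition unit_rank1 : set 'M[R]_(m1, m2) :=
  [set B | frobenius_norm B = 1 /\ (\rank B <= 1)%N].

Definition kappa1 : R := inf (l2norm @` unit_rank1).

Definition kappa1' : R := sup (l2norm @` unit_rank1).

Definition coherence : R :=
  sup [set x | exists A B, [/\ A != 0, B != 0, mxdot A B = 0 &
    x = `|l2dot A B| / (nuclear_norm A * nuclear_norm B)]].

End DesignDistribution.

Definition matrix_units (R : realType) (m1 m2 : nat) : set 'M[R]_(m1, m2) :=
  [set x | exists (j : 'I_m1) (k : 'I_m2),
    x = (delta_mx j 0 : 'cV[R]_m1) *m (delta_mx k 0 : 'cV[R]_m2)^T].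
Arguments matrix_units : clear implicits.

Section Independence.
Context {d d' : measure_display} {T : measurableType d}
  {T' : measurableType d'} {R : realType}.
Variable P : probability T R.

Definition mutually_independent (I : finType) (f : I -> T -> T') : Prop :=
  forall (J : {set I}) (B : I -> set T'),
    (forall i, i \in J -> measurable (B i)) ->
    P (\bigcap_(i in [set` J]) (f i @^-1` B i)) =
    (\prod_(i in J) fine (P (f i @^-1` B i)))%:E.

Definition has_law (f : T -> T') (Pi : probability T' R) : Prop :=
  forall B, measurable B -> P (f @^-1` B) = Pi B.

Definition identically_distributed (I : finType) (f : I -> T -> T') : Prop :=
  forall i j B, measurable B -> P (f i @^-1` B) = P (f j @^-1` B).

End Independence.

Definition independent2 {d d1 d2 : measure_display} {T : measurableType d}
    {T1 : measurableType d1} {T2 : measurableType d2} {R : realType}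
    (P : probability T R) (f : T -> T1) (g : T -> T2) : Prop :=
  forall A B, measurable A -> measurable B ->
    P ((f @^-1` A) `&` (g @^-1` B)) = (P (f @^-1` A) * P (g @^-1` B))%E.

Definition is_argmin {S : Type} {R : realType} (F : S -> R) (a : S) : Prop :=
  forall b, F a <= F b.

Definition objective {R : realType} {m1 m2 n : nat}
    (Pi : probability 'M[R]_(m1, m2) R)
    (x : 'I_n -> 'M[R]_(m1, m2)) (y : 'I_n -> R) (lambda : R)
    (A : 'M[R]_(m1, m2)) : R :=
  l2norm Pi A ^+ 2 - mxdot ((2 / n%:R) *: \sum_i y i *: x i) A
  + lambda * nuclear_norm A.

(* Main.v *)
Require Import Defs.
From HB Require Import structures.
From mathcomp Require Import all_boot all_order all_algebra.
From mathcomp Require Import spectral complex.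
From mathcomp Require Import all_classical all_reals all_analysis.
From mathcomp Require Import measurable_realfun ring lra.

(* Write D = Ahat - A0, let pi_jk be the design probabilities, so that
   <A, B>_{L2(Pi)} = sum_jk pi_jk A_jk B_jk, and let
   N = (1/n) sum_i (Y_i X_i - E Y_i X_i).

   Deterministic part. If |<N, B>| <= (lambda/4) |B|_1 for all B, comparing
   Ahat with A0 gives a cone condition, whence |D|_1 <= 24 r lambda/kappa1^2
   (all pi_jk are at least kappa1^2). The first-order condition gives
   <D, B>_{L2(Pi)} <= (3/4) lambda |B|_1. For B = u v^T with u, v unit vectors
   and s = <D, B>, the matrix D - s B is orthogonal to B, so the coherence
   bound yields s kappa1^2 <= (3/4) lambda + rho |D - s B|_1, which is at most
   6 lambda.

   Noise part. The matrix Laplace transform method is applied to the dilation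
   of N, without the Golden-Thompson inequality: as X_i is a matrix unit, its
   dilation X satisfies X^3 = X, and expanding traces in the two eigenbases of
   H and H + yX gives
     tr e^(H + yX) <= tr e^H + y tr(X e^H) + 2 y^2 e^(2 + 4|y|) tr(X^2 e^H).
   Averaging over one observation, the linear term and the centering are
   absorbed by the convexity inequality tr e^A >= tr e^B + tr (A - B) e^B.
   Independence and Markov's inequality then bound the norm of N.

   Measurability of the final event comes from the Lipschitz dependence of the
   minimizer on the data. *)

Set Implicit Arguments.
Unset Strict Implicit.
Unset Printing Implicit Defensive.

Import Order.TTheory GRing.Theory Num.Theory.
Import numFieldNormedType.Exports.

Local Open Scope classical_set_scope.
Local Open Scope ring_scope.

(** * Inner product and real spectral theorem *)

Section InnerProduct.
Context {R : realType}.

(** The noise is unbounded, so no step of the Laplace method may ask for a bounded increment: the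
    one-step trace inequality holds for every real [y], with all terms on its right taken at [H],
    and its factor [e^(2 + 4|y|)] is paid for by the exponential moment of the noise. As
    [beta >= 1], this works as soon as [theta * tau <= 1/16], where [theta] is the Laplace parameter
    and [tau = max(sigma, a)]. With [s^2 = min(m1, m2) log m / n] and [theta = s / (32 tau)], each
    observation multiplies the expected trace by at most [1 + B log m / n] for a constant [B], hence
    all of them by at most [m^B].

    Two devices reduce matrices to scalars. A trace involving two non-commuting matrices is a double
    sum over pairs of eigenvectors, one from each, so a scalar inequality in [(a_i, b_j)] is enough.
    A nuclear norm is a maximum over test matrices of operator norm at most 1, so its properties
    follow from exhibiting test matrices. *)

Lemma mxdotE m n (A B : 'M[R]_(m, n)) :
  mxdot A B = \sum_i \sum_j A i j * B i j.
Proof.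
rewrite /mxdot /mxtrace exchange_big; apply: eq_bigr => j _.
by rewrite mxE; apply: eq_bigr => i _; rewrite mxE.
Qed.

Lemma mxdotC m n (A B : 'M[R]_(m, n)) : mxdot A B = mxdot B A.
Proof. by rewrite /mxdot -mxtrace_tr trmx_mul trmxK. Qed.

Lemma mxdotDl m n (A B C : 'M[R]_(m, n)) :
  mxdot (A + B) C = mxdot A C + mxdot B C.
Proof. by rewrite /mxdot linearD mulmxDl linearD. Qed.

Lemma mxdotDr m n (A B C : 'M[R]_(m, n)) :
  mxdot C (A + B) = mxdot C A + mxdot C B.
Proof. by rewrite /mxdot mulmxDr linearD. Qed.

Lemma mxdotZl m n a (A B : 'M[R]_(m, n)) : mxdot (a *: A) B = a * mxdot A B.
Proof. by rewrite /mxdot linearZ -scalemxAl linearZ. Qed.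

Lemma mxdotZr m n a (A B : 'M[R]_(m, n)) : mxdot A (a *: B) = a * mxdot A B.
Proof. by rewrite mxdotC mxdotZl mxdotC. Qed.

Lemma mxdotNl m n (A B : 'M[R]_(m, n)) : mxdot (- A) B = - mxdot A B.
Proof. by rewrite -scaleN1r mxdotZl mulN1r. Qed.

Lemma mxdotNr m n (A B : 'M[R]_(m, n)) : mxdot A (- B) = - mxdot A B.
Proof. by rewrite mxdotC mxdotNl mxdotC. Qed.

Lemma mxdotBl m n (A B C : 'M[R]_(m, n)) :
  mxdot (A - B) C = mxdot A C - mxdot B C.
Proof. by rewrite mxdotDl mxdotNl. Qed.

Lemma mxdotBr m n (A B C : 'M[R]_(m, n)) :
  mxdot C (A - B) = mxdot C A - mxdot C B.
Proof. by rewrite mxdotDr mxdotNr. Qed.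

Lemma mxdot0l m n (A : 'M[R]_(m, n)) : mxdot 0 A = 0.
Proof. by rewrite -(scale0r 0) mxdotZl mul0r. Qed.

Lemma mxdot0r m n (A : 'M[R]_(m, n)) : mxdot A 0 = 0.
Proof. by rewrite mxdotC mxdot0l. Qed.

Lemma mxdot_mull m n p (A : 'M[R]_(m, n)) (B : 'M[R]_(n, p)) (C : 'M[R]_(m, p)) :
  mxdot (A *m B) C = mxdot B (A^T *m C).
Proof. by rewrite /mxdot trmx_mul mulmxA. Qed.

Lemma mxdot_mulr m n p (A : 'M[R]_(m, n)) (B : 'M[R]_(n, p)) (C : 'M[R]_(m, p)) :
  mxdot (A *m B) C = mxdot A (C *m B^T).
Proof. by rewrite /mxdot trmx_mul -mulmxA mxtrace_mulC mulmxA. Qed.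

Lemma mxdot_tr m n (A B : 'M[R]_(m, n)) : mxdot (A^T) (B^T) = mxdot A B.
Proof. by rewrite /mxdot trmxK mxtrace_mulC -mxtrace_tr trmx_mul trmxK. Qed.

Lemma mxdot_ge0 m n (A : 'M[R]_(m, n)) : 0 <= mxdot A A.
Proof.
by rewrite mxdotE; do 2!apply: sumr_ge0 => ? _; rewrite -expr2 sqr_ge0.
Qed.

Lemma mxdot_eq0 m n (A : 'M[R]_(m, n)) : (mxdot A A == 0) = (A == 0).
Proof.
apply/eqP/eqP => [|->]; last by rewrite mxdot0l.
rewrite mxdotE => /eqP; rewrite psumr_eq0 => [/allP /= h|i _]; last first.
  by apply: sumr_ge0 => ? _; rewrite -expr2 sqr_ge0.
apply/matrixP => i j; have := h i (mem_index_enum _).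
rewrite psumr_eq0 => [/allP /= h'|k _]; last by rewrite -expr2 sqr_ge0.
by have := h' j (mem_index_enum _); rewrite mulf_eq0 orbb mxE => /eqP.
Qed.

Lemma mxdot_gt0 m n (A : 'M[R]_(m, n)) : (0 < mxdot A A) = (A != 0).
Proof. by rewrite lt_def mxdot_ge0 andbT mxdot_eq0. Qed.

Lemma mxdot_CS m n (A B : 'M[R]_(m, n)) :
  mxdot A B ^+ 2 <= mxdot A A * mxdot B B.
Proof.
have [->|B0] := eqVneq B 0; first by rewrite !mxdot0r expr0n mulr0.
have Bp : 0 < mxdot B B by rewrite mxdot_gt0.
have := mxdot_ge0 (mxdot B B *: A - mxdot A B *: B).
rewrite mxdotBl !mxdotBr !mxdotZl !mxdotZr [mxdot B A]mxdotC => h.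
have : 0 <= mxdot B B * (mxdot A A * mxdot B B - mxdot A B ^+ 2) by nra.
by rewrite pmulr_rge0 // subr_ge0.
Qed.

Lemma frobenius_ge0 m n (A : 'M[R]_(m, n)) : 0 <= frobenius_norm A.
Proof. exact: sqrtr_ge0. Qed.

Lemma sqr_frobenius m n (A : 'M[R]_(m, n)) : frobenius_norm A ^+ 2 = mxdot A A.
Proof. by rewrite sqr_sqrtr ?mxdot_ge0. Qed.

Lemma mxdot_le_frobenius m n (A B : 'M[R]_(m, n)) :
  mxdot A B <= frobenius_norm A * frobenius_norm B.
Proof.
apply: le_trans (ler_norm _) _; rewrite -sqrtr_sqr /frobenius_norm -sqrtrM ?mxdot_ge0 //.
by rewrite ler_sqrt ?mxdot_CS // mulr_ge0 ?mxdot_ge0.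
Qed.

Lemma mxdot_cV n (u v : 'cV[R]_n) : mxdot u v = \sum_i u i 0 * v i 0.
Proof. by rewrite mxdotE; apply: eq_bigr => i _; rewrite big_ord1. Qed.

Lemma mxdot_col m n (A B : 'M[R]_(m, n)) :
  mxdot A B = \sum_j mxdot (col j A) (col j B).
Proof.
rewrite mxdotE exchange_big; apply: eq_bigr => j _.
by rewrite mxdot_cV; apply: eq_bigr => i _; rewrite !mxE.
Qed.

Lemma mxdot_rank1 m n (u : 'cV[R]_m) (v : 'cV[R]_n) :
  mxdot (u *m v^T) (u *m v^T) = mxdot u u * mxdot v v.
Proof.
rewrite mxdot_mulr trmxK -mulmxA [v^T *m v]mx11_scalar mul_mx_scalar mxdotZr.
by rewrite mulrC; congr (_ * _); rewrite /mxdot /mxtrace big_ord1.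
Qed.

End InnerProduct.

Section RealSpectral.
Context {R : realType}.

(* The rows of a Householder reflection exchanging [v] and the first basis
   vector. *)
Lemma orthogonal_complete n (v : 'rV[R]_n.+1) : v *m v^T = 1%:M ->
  exists2 U : 'M[R]_n.+1, U *m U^T = 1%:M & row 0 U = v.
Proof.
move=> v1; pose e : 'rV[R]_n.+1 := delta_mx 0 0.
have [->|ve] := eqVneq v e; first by exists 1%:M; rewrite ?trmx1 ?mulmx1 ?row1.
pose w := v - e; pose q := (w *m w^T) 0 0.
have ee : e *m e^T = 1%:M.
  by rewrite /e trmx_delta mul_delta_mx; apply/matrixP => i j; rewrite !ord1 !mxE !eqxx.
have qE : q = 2 - 2 * (e *m v^T) 0 0.
  rewrite /q /w linearB /= mulmxBl !mulmxBr v1 ee.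
  have -> : v *m e^T = (e *m v^T)^T by rewrite trmx_mul trmxK.
  by rewrite !mxE /=; ring.
have ww : w *m w^T = q%:M by rewrite [LHS]mx11_scalar.
have q0 : q != 0.
  have := mxdot_eq0 (w^T); rewrite /mxdot trmxK ww mxtrace_scalar mulr1n => ->.
  by rewrite -trmx0 (inj_eq (@trmx_inj _ _ _)) subr_eq0.
pose U := 1%:M - (2 / q) *: (w^T *m w).
have UT : U^T = U by rewrite /U linearB /= trmx1 linearZ /= trmx_mul trmxK.
exists U.
  rewrite UT {2}/U mulmxBr mulmx1 -scalemxAr {1 2}/U mulmxBl mul1mx.
  rewrite -scalemxAl mulmxA -(mulmxA _ w) ww mul_mx_scalar -scalemxAl.
  rewrite scalerA divfK // scalerBr !scalerA.
  apply/eqP; rewrite subr_eq addrC -subr_eq0; apply/eqP.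
  apply/matrixP => i j; rewrite !mxE; field.
  exact: q0.
rewrite -[row 0 U]mul1mx rowE mul1mx /U mulmxBr mulmx1 -/e.
rewrite -scalemxAr mulmxA.
have -> : e *m w^T = (- (q / 2))%:M.
  rewrite [LHS]mx11_scalar; congr (_%:M); rewrite qE /w linearB mulmxBr ee.
  by rewrite !mxE /=; field.
rewrite mul_scalar_mx scalerA.
have -> : 2 / q * - (q / 2) = -1 by field.
by rewrite scaleN1r opprK addrC subrK.
Qed.

(** Over [R[i]] the matrix is Hermitian, so its spectral diagonal is real; an eigenvalue lying in
    [R] descends from [R[i]] to [R] because the rank of [A - a] does not depend on the field. *)
Lemma symmetric_eigenvalue n (A : 'M[R]_n.+1) : A^T = A ->
  exists a, eigenvalue A a.
Proof.
move=> sA; pose Ac := map_mx (real_complex R) A.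
have hA : Ac \is hermsymmx.
  apply: realsym_hermsym; first by apply/is_hermitianmxP; apply/matrixP => i j; rewrite !mxE expr0 mul1r /= -[in LHS]sA mxE.
  by apply/mxOverP => i j; rewrite mxE; apply/complex_realP; exists (A i j).
have /orthomx_spectralP AE := hermitian_normalmx hA.
have /mxOverP /(_ 0 0) /complex_realP [a aE] := hermitian_spectral_diag_real hA.
exists a; rewrite -(eigenvalue_map (real_complex R)) -/Ac.
have PU := spectral_unit Ac.
apply/eigenvalueP; exists (row 0 (spectralmx Ac)).
  rewrite {2}AE -!row_mul !mulmxA mulmxV // mul1mx row_mul row_diag_mx aE.
  by rewrite -scalemxAl -rowE.
apply: contraTneq PU => P0; apply/negP => /mulmxV /(congr1 (row 0)).
by rewrite row_mul P0 mul0mx => /rowP /(_ 0); rewrite !mxE eqxx => /eqP; rewrite eq_sym oner_eq0.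
Qed.

(** Deflation: a unit eigenvector is completed to an orthogonal matrix, in whose basis symmetry
    makes [A] block diagonal. The eigenvectors are the rows of [Ud.1]; basis and spectrum form one
    pair so that [mx_exp] can choose them together. *)
Lemma real_spectral n (A : 'M[R]_n) : A^T = A ->
  exists Ud : 'M[R]_n * 'rV[R]_n,
    Ud.1 *m Ud.1^T = 1%:M /\ A = Ud.1^T *m diag_mx Ud.2 *m Ud.1.
Proof.
elim: n A => [|n IHn] A sA.
  by exists (0, 0); split; apply/matrixP => -[].
have [a /eigenvalueP[v vA v0]] := symmetric_eigenvalue sA.
have vv : 0 < mxdot v v by rewrite mxdot_gt0.
pose u := (Num.sqrt (mxdot v v))^-1 *: v.
have u1 : u *m u^T = 1%:M.
  rewrite /u linearZ /= -scalemxAl -scalemxAr scalerA [v *m _]mx11_scalar.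
  rewrite -invrM ?unitfE ?sqrtr_eq0 -?ltNge // -expr2 sqr_sqrtr ?ltW //.
  have -> : (v *m v^T) 0 0 = mxdot v v.
    by rewrite /mxdot mxtrace_mulC /mxtrace big_ord1.
  by rewrite scale_scalar_mx mulVf // gt_eqF.
have uA : u *m A = a *: u by rewrite /u -scalemxAl vA !scalerA mulrC.
have [U UU U0] := orthogonal_complete u1.
have UTU := mulmx1C UU.
have [B BdE] : exists B : 'M[R]_(1 + n), B = U *m A *m U^T by eexists.
have BT : B^T = B by rewrite BdE !trmx_mul trmxK sA mulmxA.
have B0 : row 0 B = a *: delta_mx 0 0.
  by rewrite BdE !row_mul U0 uA -scalemxAl -U0 -row_mul UU row1.
have BE : B = block_mx a%:M 0 0 (drsubmx B).
  rewrite -[LHS]submxK; congr block_mx.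
  - rewrite [LHS]mx11_scalar; congr (_%:M).
    by have /rowP/(_ 0) := B0; rewrite !mxE !eqxx mulr1 => <-; congr (B _ _); exact/val_inj.
  - apply/rowP => j; have /rowP/(_ (rshift 1 j)) := B0.
    by rewrite !mxE /= mulr0 => <-; congr (B _ _); exact/val_inj.
  - apply/colP => j; have /rowP/(_ (rshift 1 j)) := B0.
    rewrite -{1}BT !mxE /= mulr0 => <-; congr (B _ _); exact/val_inj.
have [|[V d] /= [VV VE]] := IHn (drsubmx B).
  by rewrite trmx_drsub BT.
pose W : 'M[R]_(1 + n) := block_mx 1%:M 0 0 V.
have WW : W *m W^T = 1%:M.
  rewrite /W tr_block_mx !trmx0 trmx1 mulmx_block !mulmx0 !mul0mx !addr0 !add0r.
  by rewrite mulmx1 VV -scalar_mx_block.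
exists (W *m U, row_mx a%:M d) => /=; split.
  by rewrite trmx_mul mulmxA -(mulmxA W) UU mulmx1 WW.
have -> : A = U^T *m B *m U.
  by rewrite BdE !mulmxA UTU mul1mx -mulmxA UTU mulmx1.
suff -> : B = W^T *m diag_mx (row_mx a%:M d) *m W by rewrite trmx_mul !mulmxA.
rewrite BE (@diag_mx_row R n 1) /W tr_block_mx !trmx0 trmx1 !mulmx_block.
rewrite !(mul0mx, mulmx0, addr0, add0r, mul1mx, mulmx1) -VE.
by congr (block_mx _ _ _ _); apply/matrixP => i j; rewrite !ord1 !mxE.
Qed.

End RealSpectral.

(** * Nuclear and spectral norms *)

(** Serves for two diagonalizations over [R[i]], the unitary one behind the singular values and the
    image of a real orthogonal one; hence a one-sided inverse [P] in place of a transpose or an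
    adjoint. *)
Lemma char_poly_diagonalized (F : comNzRingType) n (U P : 'M[F]_n) (s : 'rV_n) :
  U *m P = 1%:M ->
  char_poly (U *m diag_mx s *m P) = \prod_i ('X - (s 0 i)%:P).
Proof.
move=> UP; pose c := @map_mx _ _ (@polyC F) n n.
have cUP : c U *m c P = 1%:M by rewrite -map_mxM UP map_mx1.
have -> : char_poly (U *m diag_mx s *m P) =
    \det (c U *m ('X%:M - c (diag_mx s)) *m c P).
  rewrite /char_poly /char_poly_mx mulmxBr mulmxBl -!map_mxM mul_mx_scalar.
  by rewrite -scalemxAl cUP scalemx1.
rewrite !det_mulmx mulrC mulrA -det_mulmx (mulmx1C cUP) det1 mul1r.
rewrite /c map_diag_mx -diag_const_mx -raddfB det_diag.
by apply: eq_bigr => i _; rewrite !mxE.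
Qed.

Section SingularValues.
Context {R : realType} {m n : nat}.
Implicit Types A W : 'M[R]_(m, n).

(** Both spectra are the roots of the characteristic polynomial of [A^T A]. This frees the singular
    values from the complex diagonalization in their definition: any real one may be used. *)
Lemma singular_value_perm A (U : 'M[R]_n) (d : 'rV[R]_n) :
  U *m U^T = 1%:M -> A^T *m A = U^T *m diag_mx d *m U ->
  perm_eq [seq singular_value A j | j : 'I_n] [seq Num.sqrt (d 0 j) | j : 'I_n].
Proof.
move=> UU AE; pose f := real_complex R; pose B := map_mx f (A^T *m A).
have hB : B \is hermsymmx.
  apply: realsym_hermsym.
    apply/is_hermitianmxP; apply/matrixP => i j; rewrite !mxE expr0 mul1r /=.
    by congr (f _); apply: eq_bigr => k _; rewrite !mxE mulrC.
  by apply/mxOverP => i j; rewrite mxE; apply/complex_realP; exists ((A^T *m A) i j).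
have /orthomx_spectralP BE := hermitian_normalmx hB.
have E1 : char_poly B = \prod_i ('X - (spectral_diag B 0 i)%:P).
  by rewrite BE char_poly_diagonalized -?BE // mulVmx ?spectral_unit.
have E2 : char_poly B = \prod_i ('X - (f (d 0 i))%:P).
  rewrite /B AE !map_mxM map_diag_mx char_poly_diagonalized.
    by apply: eq_bigr => i _; rewrite mxE.
  by rewrite -map_mxM (mulmx1C UU) map_mx1.
have : perm_eq [seq spectral_diag B 0 i | i : 'I_n] [seq f (d 0 i) | i : 'I_n].
  by apply: prod_XsubC_eq; rewrite !big_image -E1 -E2.
move=> /(perm_map (fun z => Num.sqrt (complex.Re z))).
by rewrite -[X in perm_eq X _]map_comp -[X in perm_eq _ X]map_comp.
Qed.

(** A singular value decomposition without left singular vectors: the columns of [A U^T] are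
    orthogonal with norms [s_j], so zero singular values need no separate treatment. *)
Lemma gram_diagonalization A : exists (U : 'M[R]_n) (s : 'rV[R]_n),
  [/\ U *m U^T = 1%:M, forall j, 0 <= s 0 j,
      (A *m U^T)^T *m (A *m U^T) = diag_mx (\row_j s 0 j ^+ 2) &
      perm_eq [seq singular_value A j | j : 'I_n] [seq s 0 j | j : 'I_n]].
Proof.
have [|[U d] /= [UU AE]] := @real_spectral R n (A^T *m A).
  by rewrite trmx_mul trmxK.
have GE : (A *m U^T)^T *m (A *m U^T) = diag_mx d.
  rewrite trmx_mul trmxK -mulmxA (mulmxA A^T) AE -!mulmxA UU mulmx1.
  by rewrite mulmxA UU mul1mx.
have d0 j : 0 <= d 0 j.
  have -> : d 0 j = mxdot (col j (A *m U^T)) (col j (A *m U^T)).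
    have -> : d 0 j = diag_mx d j j by rewrite mxE eqxx mulr1n.
    by rewrite -GE mxE mxdot_cV; apply: eq_bigr => i _; rewrite !mxE.
  exact: mxdot_ge0.
exists U, (\row_j Num.sqrt (d 0 j)); split => //.
- by move=> j; rewrite mxE sqrtr_ge0.
- by rewrite GE; congr diag_mx; apply/rowP => j; rewrite !mxE sqr_sqrtr.
- rewrite (perm_trans (singular_value_perm UU AE)) //.
  suff -> : [seq (\row_k Num.sqrt (d 0 k)) 0 j | j : 'I_n] =
    [seq Num.sqrt (d 0 j) | j : 'I_n] by [].
  by apply: eq_map => j; rewrite mxE.
Qed.

End SingularValues.

(** Operator norm at most 1, stated on vectors so that no singular value of [W] is involved: the
    unit ball dual to the nuclear norm. *)
Definition nonexpansive {R : realType} m n (W : 'M[R]_(m, n)) : Prop :=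
  forall v : 'cV[R]_n, mxdot (W *m v) (W *m v) <= mxdot v v.

Section Nonexpansive.
Context {R : realType}.

Lemma nonexpansive_mx m n p (W : 'M[R]_(m, n)) (B : 'M[R]_(n, p)) :
  nonexpansive W -> mxdot (W *m B) (W *m B) <= mxdot B B.
Proof.
move=> cW; rewrite mxdot_col (mxdot_col B); apply: ler_sum => j _.
by rewrite !colE -!mulmxA cW.
Qed.

Lemma nonexpansive_tr m n (W : 'M[R]_(m, n)) : nonexpansive W -> nonexpansive W^T.
Proof.
move=> cW u; set x := mxdot _ _.
have x0 : 0 <= x by exact: mxdot_ge0.
have xE : x = mxdot u (W *m (W^T *m u)).
  by rewrite /x mxdot_mull trmxK mxdotC mxdotC.
have : x ^+ 2 <= mxdot u u * x.
  rewrite {1}xE; apply: le_trans (mxdot_CS _ _) _.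
  by rewrite ler_wpM2l ?mxdot_ge0 ?cW.
have [->|xn0] := eqVneq x 0; first by rewrite mxdot_ge0.
by rewrite expr2 ler_pM2r // lt_def xn0.
Qed.

Lemma nonexpansive_mxr m n p (W : 'M[R]_(m, n)) (B : 'M[R]_(p, m)) :
  nonexpansive W -> mxdot (B *m W) (B *m W) <= mxdot B B.
Proof.
move=> /nonexpansive_tr cW; rewrite -mxdot_tr trmx_mul -(mxdot_tr B).
exact: nonexpansive_mx.
Qed.

Lemma projection_pythagoras n p (P : 'M[R]_n) (v : 'M[R]_(n, p)) :
  P^T = P -> P *m P = P ->
  mxdot v v = mxdot (P *m v) (P *m v) + mxdot (v - P *m v) (v - P *m v).
Proof.
move=> PT PP; have h : mxdot (P *m v) v = mxdot (P *m v) (P *m v).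
  by rewrite [RHS]mxdot_mull PT mulmxA PP mxdotC.
by rewrite mxdotBl !mxdotBr (mxdotC v) h; ring.
Qed.

Lemma partial_isometry_nonexpansive m n (W : 'M[R]_(m, n)) :
  W *m W^T *m W = W -> nonexpansive W.
Proof.
move=> WW v; have PT : (W^T *m W)^T = W^T *m W by rewrite trmx_mul trmxK.
have PP : W^T *m W *m (W^T *m W) = W^T *m W by rewrite -mulmxA (mulmxA W) WW.
rewrite (projection_pythagoras v PT PP) mxdot_mull mulmxA.
suff -> : mxdot v (W^T *m W *m v) = mxdot (W^T *m W *m v) (W^T *m W *m v).
  by rewrite lerDl mxdot_ge0.
by rewrite [RHS]mxdot_mull PT mulmxA PP.
Qed.

End Nonexpansive.

Lemma mulmx_cV_le {R : realType} m n (A : 'M[R]_(m, n)) (v : 'cV[R]_n) :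
  mxdot (A *m v) (A *m v) <= mxdot A A * mxdot v v.
Proof.
rewrite mxdot_cV -(mxdot_tr A) mxdot_col mulr_suml; apply: ler_sum => i _.
rewrite -expr2; have -> : (A *m v) i 0 = mxdot (col i A^T) v.
  by rewrite mxdot_cV mxE; apply: eq_bigr => k _; rewrite !mxE.
exact: mxdot_CS.
Qed.

Section NuclearNorm.
Context {R : realType} {m n : nat}.
Implicit Types A B W : 'M[R]_(m, n).


Lemma nuclear_normE A (s : 'rV[R]_n) :
  perm_eq [seq singular_value A j | j : 'I_n] [seq s 0 j | j : 'I_n] ->
  nuclear_norm A = \sum_j s 0 j.
Proof.
move=> As; rewrite /nuclear_norm -(big_image _ _ _ _ id) (perm_big _ As) /=.
by rewrite big_image.
Qed.

(** Cauchy-Schwarz column by column in the eigenbasis of [A^T A]: a column of [A U^T] has norm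
    [s_j], a column of [W U^T] has norm at most 1. *)
Lemma nuclear_norm_ge A W : nonexpansive W -> mxdot A W <= nuclear_norm A.
Proof.
move=> cW; have [U [s [UU s0 GE /nuclear_normE->]]] := gram_diagonalization A.
have -> : mxdot A W = mxdot (A *m U^T) (W *m U^T).
  by rewrite mxdot_mulr trmxK -mulmxA (mulmx1C UU) mulmx1.
rewrite mxdot_col; apply: ler_sum => j _.
apply: le_trans (mxdot_le_frobenius _ _) _.
have -> : frobenius_norm (col j (A *m U^T)) = s 0 j.
  rewrite /frobenius_norm; have -> : mxdot (col j (A *m U^T)) (col j (A *m U^T)) = s 0 j ^+ 2.
    have -> : s 0 j ^+ 2 = diag_mx (\row_j s 0 j ^+ 2) j j.
      by rewrite !mxE eqxx mulr1n.
    by rewrite -GE mxE mxdot_cV; apply: eq_bigr => i _; rewrite !mxE.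
  by rewrite sqrtr_sqr ger0_norm.
rewrite ler_piMr // -[leRHS]sqrtr1 ler_sqrt // colE -mulmxA.
apply: le_trans (cW _) _; rewrite /mxdot trmx_mul trmxK.
by rewrite -mulmxA (mulmxA U) UU mul1mx trmx_delta mul_delta_mx /mxtrace big_ord1 mxE !eqxx.
Qed.

(* The partial isometry of the polar decomposition attains the duality bound
   [nuclear_norm_ge]. *)
Lemma polar_decomposition A : exists W : 'M[R]_(m, n),
  [/\ W *m W^T *m W = W, W *m W^T *m A = A, A *m (W^T *m W) = A,
      mxdot A W = nuclear_norm A & mxdot W W <= (\rank A)%:R].
Proof.
have [U [s [UU s0 GE /nuclear_normE->]]] := gram_diagonalization A.
have UTU := mulmx1C UU.
have [B BE] : exists B, A *m U^T = B by eexists.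
rewrite BE in GE; pose D (f : R -> R) : 'M[R]_n := diag_mx (\row_j f (s 0 j)).
have DM f g : D f *m D g = D (fun x => f x * g x).
  by rewrite /D mulmx_diag; congr diag_mx; apply/rowP => j; rewrite !mxE.
have DT f : (D f)^T = D f by rewrite /D tr_diag_mx.
have Dext f g : f =1 g -> D f = D g.
  by move=> fg; congr diag_mx; apply/rowP => j; rewrite !mxE fg.
have {}GE : B^T *m B = D (fun x => x ^+ 2) by [].
have AE : A = B *m U by rewrite -BE -mulmxA UTU mulmx1.
pose chi (x : R) : R := (x != 0)%:R.
(* A column of [B] with [s_j = 0] has norm 0, so discarding these columns changes nothing. *)
have Bchi : B *m D chi = B.
  apply/eqP; rewrite eq_sym -subr_eq0 -mxdot_eq0 /mxdot.
  have -> : B - B *m D chi = B *m D (fun x => 1 - chi x).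
    rewrite -{1}[B]mulmx1 -mulmxBr; congr (_ *m _).
    by apply/matrixP => i j; rewrite !mxE; case: eqP => _; rewrite ?mulr1n ?subrr ?mulr0n ?subr0.
  rewrite trmx_mul DT mulmxA -(mulmxA _ B^T) GE !DM (Dext _ (fun=> 0)).
    by rewrite /mxtrace big1 // => i _; rewrite !mxE mul0rn.
  move=> x; rewrite /chi; case: eqP => [->|_] /=; rewrite ?expr0n /= ?(mulr0, mul0r) //.
  by rewrite subrr mulr0.
(* As [GRing.inv] sends 0 to 0, [D GRing.inv] is the pseudo-inverse of the diagonal of singular
   values. *)
have [W WE] : exists W, W = B *m D GRing.inv *m U by eexists.
have WT : W^T = U^T *m D GRing.inv *m B^T.
  by rewrite WE !trmx_mul DT mulmxA.
have WTB : W^T *m B = U^T *m D id.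
  rewrite WT -mulmxA GE -mulmxA DM; congr (_ *m _); apply: Dext => x.
  by have [->|x0] := eqVneq x 0; rewrite ?invr0 ?mul0r // expr2 mulKf.
have WTW : W^T *m W = U^T *m D chi *m U.
  rewrite {2}WE 2!mulmxA WTB -(mulmxA U^T) DM; congr (_ *m _ *m _); apply: Dext => x.
  by rewrite /chi; have [->|x0] := eqVneq x 0; rewrite ?mul0r // divff.
exists W; split.
- rewrite -mulmxA WTW WE -!mulmxA (mulmxA U) UU mul1mx (mulmxA (D _)) DM.
  rewrite (Dext _ GRing.inv) ?mulmxA // => x.
  by rewrite /chi; have [->|x0] := eqVneq x 0; rewrite ?mulr0 ?invr0 // mulr1.
- rewrite -mulmxA {1}AE (mulmxA W^T) WTB {1}WE -!mulmxA (mulmxA U) UU mul1mx.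
  rewrite (mulmxA (D _)) DM (Dext _ chi) ?mulmxA ?Bchi // => x.
  by rewrite /chi; have [->|x0] := eqVneq x 0; rewrite ?mulr0 // mulVf.
- by rewrite WTW AE -!mulmxA (mulmxA U) UU mul1mx (mulmxA B) Bchi.
- rewrite mxdotC /mxdot AE mulmxA WTB -mulmxA mxtrace_mulC -mulmxA UU mulmx1.
  by rewrite /mxtrace; apply: eq_bigr => i _; rewrite !mxE eqxx mulr1n.
rewrite /mxdot WTW mxtrace_mulC mulmxA UU mul1mx.
have -> : \tr (D chi) = #|[set j | s 0 j != 0]%SET|%:R.
  rewrite -sum1_card natr_sum big_mkcond /=; apply: eq_bigr => j _.
  by rewrite !mxE eqxx mulr1n finset.inE /chi; case: eqP.
(* [K] selects the indices of nonzero singular values. The Gram matrix compressed to them is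
   invertible of size [#|S|], which bounds [#|S|] by the rank of [A]. *)
rewrite ler_nat; set S := [set j | _]%SET; pose K := rowsub (fun i : 'I_#|S| => enum_val i) (1%:M : 'M[R]_n).
have KDE : K *m D (fun x => x ^+ 2) *m K^T =
    diag_mx (\row_j s 0 (enum_val j) ^+ 2).
  rewrite /K mul_rowsub_mx mul1mx trmx_mxsub trmx1 mulmx_colsub mulmx1.
  by apply/matrixP => i j; rewrite !mxE (inj_eq enum_val_inj).
have rkK : \rank (K *m D (fun x => x ^+ 2) *m K^T) = #|S|.
  apply: mxrank_unit; rewrite KDE unitmxE det_diag unitfE; apply/prodf_neq0 => j _.
  by rewrite mxE expf_neq0 //; have := enum_valP j; rewrite finset.inE.
rewrite -rkK -GE -!mulmxA; apply: leq_trans (mxrankM_maxr _ _) _.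
apply: leq_trans (mxrankM_maxr _ _) _; rewrite -BE -mulmxA.
exact: mxrankM_maxl.
Qed.

Lemma nuclear_norm_ge0 A : 0 <= nuclear_norm A.
Proof.
have := nuclear_norm_ge A (W := 0); rewrite mxdot0r; apply=> v.
by rewrite mul0mx mxdot0l mxdot_ge0.
Qed.

(** With [nuclear_norm_ge], this makes the nuclear norm a maximum of linear forms; the triangle
    inequality and homogeneity follow by testing at a maximizer. *)
Lemma nuclear_norm_dual A : exists2 W : 'M[R]_(m, n),
  nonexpansive W & mxdot A W = nuclear_norm A.
Proof.
have [W [WW _ _ AW _]] := polar_decomposition A; exists W => //.
exact: partial_isometry_nonexpansive.
Qed.

Lemma nuclear_normD A B : nuclear_norm (A + B) <= nuclear_norm A + nuclear_norm B.
Proof.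
have [W cW <-] := nuclear_norm_dual (A + B).
by rewrite mxdotDl lerD ?nuclear_norm_ge.
Qed.

Lemma nuclear_normZ a A : 0 <= a -> nuclear_norm (a *: A) = a * nuclear_norm A.
Proof.
move=> a0; apply/eqP; rewrite eq_le; apply/andP; split.
  have [W cW <-] := nuclear_norm_dual (a *: A).
  by rewrite mxdotZl ler_wpM2l ?nuclear_norm_ge.
by have [W cW <-] := nuclear_norm_dual A; rewrite -mxdotZl nuclear_norm_ge.
Qed.

Lemma nuclear_normN A : nuclear_norm (- A) = nuclear_norm A.
Proof.
suff le B : nuclear_norm (- B) <= nuclear_norm B.
  by apply/eqP; rewrite eq_le le -{1}(opprK A) le.
have [W cW <-] := nuclear_norm_dual (- B).
rewrite mxdotNl -mxdotNr nuclear_norm_ge // => v.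
by rewrite mulNmx mxdotNl mxdotNr opprK.
Qed.

Lemma frobenius_le_nuclear A : frobenius_norm A <= nuclear_norm A.
Proof.
have [->|A0] := eqVneq A 0.
  by rewrite /frobenius_norm mxdot0l sqrtr0 nuclear_norm_ge0.
have F0 : 0 < frobenius_norm A by rewrite sqrtr_gt0 mxdot_gt0.
have -> : frobenius_norm A = mxdot A ((frobenius_norm A)^-1 *: A).
  by rewrite mxdotZr -sqr_frobenius expr2 mulKf // gt_eqF.
apply: nuclear_norm_ge => v; rewrite -scalemxAl mxdotZl mxdotZr mulrA.
rewrite -expr2 exprVn sqr_frobenius ler_pdivrMl ?mxdot_gt0 //.
exact: mulmx_cV_le.
Qed.

Lemma nuclear_rank1_le (u : 'cV[R]_m) (v : 'cV[R]_n) :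
  mxdot u u = 1 -> mxdot v v = 1 -> nuclear_norm (u *m v^T) <= 1.
Proof.
move=> u1 v1; have [W cW <-] := nuclear_norm_dual (u *m v^T).
rewrite mxdot_mulr trmxK (le_trans (mxdot_le_frobenius _ _)) //.
rewrite /frobenius_norm u1 sqrtr1 mul1r -[leRHS]sqrtr1 ler_sqrt //.
by rewrite (le_trans (cW _)) ?v1.
Qed.

End NuclearNorm.

Section SpectralNorm.
Context {R : realType}.

Lemma mulmx_spectral_norm m n (A : 'M[R]_(m, n)) (v : 'cV[R]_n) :
  mxdot (A *m v) (A *m v) <= spectral_norm A ^+ 2 * mxdot v v.
Proof.
have [U [s [UU s0 GE sA]]] := gram_diagonalization A.
have sle j : s 0 j ^+ 2 <= spectral_norm A ^+ 2.
  have : s 0 j \in [seq singular_value A j | j : 'I_n].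
    by rewrite (perm_mem sA) fintype.image_f.
  case/fintype.imageP => k _ ->; rewrite lerXn2r ?nnegrE ?sqrtr_ge0 //; last first.
    exact: le_bigmax.
  by rewrite (le_trans _ (le_bigmax _ _ k)) ?sqrtr_ge0.
have -> : A *m v = (A *m U^T) *m (U *m v).
  by rewrite mulmxA -(mulmxA A) (mulmx1C UU) mulmx1.
rewrite [leLHS]mxdot_mull mulmxA GE.
have -> : mxdot v v = mxdot (U *m v) (U *m v).
  by rewrite [RHS]mxdot_mull mulmxA (mulmx1C UU) mul1mx.
rewrite !mxdot_cV mulr_sumr; apply: ler_sum => i _.
rewrite mul_diag_mx !mxE mulrCA mulrA -mulrA -expr2.
by rewrite ler_wpM2r ?sqr_ge0.
Qed.

Lemma spectral_norm_ge0 m n (A : 'M[R]_(m, n)) : 0 <= spectral_norm A.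
Proof.
by rewrite /spectral_norm; elim/big_ind: _ => // [x y x0 _|j _]; rewrite ?le_max ?x0 ?sqrtr_ge0.
Qed.

Lemma spectral_norm_le m n (A : 'M[R]_(m, n)) (c : R) : 0 <= c ->
  (forall v : 'cV[R]_n, mxdot (A *m v) (A *m v) <= c ^+ 2 * mxdot v v) ->
  spectral_norm A <= c.
Proof.
move=> c0 Ac; have [U [s [UU s0 GE sA]]] := gram_diagonalization A.
apply: bigmax_le => // j _.
have : singular_value A j \in [seq s 0 j | j : 'I_n].
  by rewrite -(perm_mem sA) fintype.image_f.
case/fintype.imageP => k _ ->; rewrite -(@ler_pXn2r _ 2) ?nnegrE //.
have -> : s 0 k ^+ 2 = mxdot (col k (A *m U^T)) (col k (A *m U^T)).
  have -> : s 0 k ^+ 2 = diag_mx (\row_j s 0 j ^+ 2) k k.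
    by rewrite !mxE eqxx mulr1n.
  by rewrite -GE mxE mxdot_cV; apply: eq_bigr => i _; rewrite !mxE.
rewrite colE -mulmxA (le_trans (Ac _)) // ler_piMr ?sqr_ge0 //.
rewrite /mxdot trmx_mul trmxK -mulmxA (mulmxA U) UU mul1mx trmx_delta.
by rewrite mul_delta_mx /mxtrace big_ord1 mxE !eqxx.
Qed.

(** Apply the hypothesis to the normalized vectors [A v / |A v|] and [v / |v|]. The conclusion is
    about vectors because it feeds [mxdot_le_nuclear] as well as [spectral_norm_le]. *)
Lemma spectral_norm_le_bilinear m n (A : 'M[R]_(m, n)) (c : R) : 0 <= c ->
  (forall (u : 'cV[R]_m) (v : 'cV[R]_n), mxdot u u = 1 -> mxdot v v = 1 ->
     mxdot A (u *m v^T) <= c) ->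
  forall v : 'cV[R]_n, mxdot (A *m v) (A *m v) <= c ^+ 2 * mxdot v v.
Proof.
move=> c0 Ac v.
have [->|v0] := eqVneq v 0; first by rewrite mulmx0 !mxdot0l mulr0.
have [->|w0] := eqVneq (A *m v) 0; first by rewrite mxdot0l mulr_ge0 ?sqr_ge0 ?mxdot_ge0.
pose nrm p (x : 'cV[R]_p) := (frobenius_norm x)^-1 *: x.
have F0 p (x : 'cV[R]_p) : x != 0 -> 0 < frobenius_norm x.
  by move=> x0; rewrite sqrtr_gt0 mxdot_gt0.
have n1 p (x : 'cV[R]_p) : x != 0 -> mxdot (nrm _ x) (nrm _ x) = 1.
  move=> x0; rewrite mxdotZl mxdotZr mulrA -expr2 exprVn sqr_frobenius mulVf //.
  by rewrite mxdot_eq0.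
have := Ac _ _ (n1 _ _ w0) (n1 _ _ v0).
have AvE : mxdot A (A *m v *m v^T) = mxdot (A *m v) (A *m v).
  by rewrite mxdotC mxdot_mulr trmxK.
rewrite /nrm linearZ /= -scalemxAl -scalemxAr !mxdotZr AvE.
rewrite -sqr_frobenius -(sqr_frobenius v) -exprMn.
move: (F0 _ _ w0) (F0 _ _ v0); set a := frobenius_norm _; set b := frobenius_norm _.
move=> a0 b0; rewrite mulrCA expr2 mulKf ?gt_eqF // ler_pdivrMl // mulrC => ab.
rewrite -expr2; apply: lerXn2r => //; rewrite nnegrE ?(ltW a0) // mulr_ge0 //; exact: ltW.
Qed.

Lemma mxdot_le_nuclear m n (A B : 'M[R]_(m, n)) (c : R) : 0 < c ->
  (forall v : 'cV[R]_n, mxdot (A *m v) (A *m v) <= c ^+ 2 * mxdot v v) ->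
  mxdot A B <= c * nuclear_norm B.
Proof.
move=> c0 Ac; rewrite mxdotC -[leLHS](mulKf (lt0r_neq0 c0)) mulrCA ler_wpM2l ?(ltW c0) //.
rewrite -mxdotZr nuclear_norm_ge // => v.
rewrite -scalemxAl mxdotZl mxdotZr mulrA -expr2 exprVn.
by rewrite ler_pdivrMl ?exprn_gt0 ?Ac.
Qed.

End SpectralNorm.

(** * Splitting along the row and column spaces of a low-rank matrix *)

Section LowRankSplit.
Context {R : realType} {m n : nat}.

(* [D2] is [D] compressed to the orthogonal complements of the column and row
   spaces of [A], so its dual certificate can be glued to the one of [A]. *)
Lemma low_rank_split (A D : 'M[R]_(m, n)) : exists D1 D2 : 'M[R]_(m, n),
  [/\ D = D1 + D2,
      nuclear_norm D1 <= 2 * Num.sqrt (\rank A)%:R * frobenius_norm D &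
      nuclear_norm A + nuclear_norm D2 <= nuclear_norm (A + D2)].
Proof.
have [W [WW PA AQ AW rkW]] := polar_decomposition A.
have cW := partial_isometry_nonexpansive WW.
have [P PE] : exists P, P = W *m W^T by eexists.
have [Q QE] : exists Q, Q = W^T *m W by eexists.
rewrite -PE in PA; rewrite -QE in AQ.
have PT : P^T = P by rewrite PE trmx_mul trmxK.
have QT : Q^T = Q by rewrite QE trmx_mul trmxK.
have PW : P *m W = W by rewrite PE.
have WQ : W *m Q = W by rewrite QE mulmxA.
have PP : P *m P = P by rewrite {2}PE mulmxA PW -PE.
have QQ : Q *m Q = Q by rewrite {1}QE -mulmxA WQ -QE.
have pP : (1%:M - P)^T = 1%:M - P by rewrite linearB /= trmx1 PT.
have pQ : (1%:M - Q)^T = 1%:M - Q by rewrite linearB /= trmx1 QT.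
have ppP : (1%:M - P) *m (1%:M - P) = 1%:M - P.
  by rewrite mulmxBr mulmx1 mulmxBl mul1mx PP subrr subr0.
have ppQ : (1%:M - Q) *m (1%:M - Q) = 1%:M - Q.
  by rewrite mulmxBr mulmx1 mulmxBl mul1mx QQ subrr subr0.
have cP : nonexpansive (1%:M - P).
  by apply: partial_isometry_nonexpansive; rewrite pP ppP.
(* [D1] is a sum of two pieces. The test matrix of each, once moved onto [D], is dominated in
   Frobenius norm by [W], whose square norm is at most the rank of [A]; hence the factor 2. *)
have le V : mxdot V V <= mxdot W W -> mxdot D V <= Num.sqrt (\rank A)%:R * frobenius_norm D.
  move=> VW; rewrite mulrC (le_trans (mxdot_le_frobenius _ _)) //.
  by rewrite ler_wpM2l ?frobenius_ge0 // ler_sqrt ?ler0n // (le_trans VW).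
exists (P *m D + (1%:M - P) *m D *m Q), ((1%:M - P) *m D *m (1%:M - Q)); split.
- by rewrite mulmxBr mulmx1 -addrA (addrC (_ *m Q)) subrK mulmxBl mul1mx addrC subrK.
- apply: le_trans (nuclear_normD _ _) _; rewrite -mulrA mulr_natl mulr2n lerD //.
    have [V cV <-] := nuclear_norm_dual (P *m D).
    rewrite mxdot_mull PT le // PE -mulmxA (le_trans (nonexpansive_mx _ cW)) //.
    by rewrite (le_trans (nonexpansive_mxr _ cV)) // mxdot_tr.
  have [V cV <-] := nuclear_norm_dual ((1%:M - P) *m D *m Q).
  rewrite mxdot_mulr mxdot_mull pP QT le // (le_trans (nonexpansive_mx _ cP)) //.
  rewrite (le_trans (nonexpansive_mx _ cV)) // QE.
  exact: nonexpansive_mx (nonexpansive_tr cW).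
have [V cV <-] := nuclear_norm_dual ((1%:M - P) *m D *m (1%:M - Q)).
set D2 := (1%:M - P) *m D *m (1%:M - Q).
(* The glued certificate: [W] sees only the [Q] component of a vector and maps into the range of
   [P], the other term sees only the complement of [Q] and maps into the complement of [P], so
   Pythagoras keeps [Z] nonexpansive. *)
pose Z := W + (1%:M - P) *m V *m (1%:M - Q).
have P0W : (1%:M - P) *m W = 0 by rewrite mulmxBl mul1mx PW subrr.
have cZ : nonexpansive Z.
  move=> x; have -> : Z *m x = W *m x + (1%:M - P) *m (V *m (x - Q *m x)).
    by rewrite /Z [LHS]mulmxDl -!mulmxA [X in V *m X]mulmxBl mul1mx.
  have W0 y : mxdot (W *m x) ((1%:M - P) *m y) = 0.
    by rewrite mxdotC mxdot_mull pP mulmxA P0W mul0mx mxdot0r.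
  rewrite mxdotDl !mxdotDr W0 mxdotC W0 addr0 add0r.
  rewrite [leRHS](projection_pythagoras x QT QQ) lerD //.
    by rewrite -{1 2}WQ -mulmxA cW.
  by rewrite (le_trans (nonexpansive_mx _ cP)).
rewrite -AW; suff -> : mxdot A W + mxdot D2 V = mxdot (A + D2) Z by exact: nuclear_norm_ge.
rewrite /Z mxdotDl !mxdotDr.
have -> : mxdot A ((1%:M - P) *m V *m (1%:M - Q)) = 0.
  rewrite mxdotC -mulmxA mxdot_mull pP mulmxBl mul1mx PA subrr mxdot0r //.
have -> : mxdot D2 W = 0 by rewrite /D2 -mulmxA mxdot_mull pP P0W mxdot0r.
rewrite addr0 add0r; congr (_ + _).
rewrite [RHS]mxdotC [RHS]mxdot_mulr [RHS]mxdot_mull pP pQ /D2.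
by rewrite !mulmxA ppP -(mulmxA _ (1%:M - Q)) ppQ mxdotC.
Qed.

End LowRankSplit.

(** * Penalized least squares *)

(** The inner product of [L2(Pi)] when [Pi] lives on matrix units and [w] is its matrix of
    probabilities ([l2dot_unit_design]). With [w] abstract, the deterministic part is free of
    measure theory. *)
Definition wdot {R : realType} m n (w A B : 'M[R]_(m, n)) : R :=
  \sum_i \sum_j w i j * (A i j * B i j).

Section WeightedProduct.
Context {R : realType} {m n : nat}.
Implicit Types w A B C : 'M[R]_(m, n).

Lemma wdotE w A B : wdot w A B = mxdot (\matrix_(i, j) (w i j * A i j)) B.
Proof.
by rewrite mxdotE; do 2!apply: eq_bigr => ? _; rewrite mxE mulrA.
Qed.

Lemma wdotC w A B : wdot w A B = wdot w B A.
Proof. by do 2!apply: eq_bigr => ? _; rewrite (mulrC (A _ _)). Qed.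

Lemma wdotDr w A B C : wdot w A (B + C) = wdot w A B + wdot w A C.
Proof. by rewrite !wdotE mxdotDr. Qed.

Lemma wdotZr w a A B : wdot w A (a *: B) = a * wdot w A B.
Proof. by rewrite !wdotE mxdotZr. Qed.

Lemma wdotDl w A B C : wdot w (A + B) C = wdot w A C + wdot w B C.
Proof. by rewrite ![wdot w _ C]wdotC wdotDr. Qed.

Lemma wdotZl w a A B : wdot w (a *: A) B = a * wdot w A B.
Proof. by rewrite ![wdot w _ B]wdotC wdotZr. Qed.

Lemma wdotNr w A B : wdot w A (- B) = - wdot w A B.
Proof. by rewrite -scaleN1r wdotZr mulN1r. Qed.

Lemma wdotNl w A B : wdot w (- A) B = - wdot w A B.
Proof. by rewrite -scaleN1r wdotZl mulN1r. Qed.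

Lemma wdot_ge w k A : (forall i j, k <= w i j) -> k * mxdot A A <= wdot w A A.
Proof.
move=> kw; rewrite mxdotE mulr_sumr; apply: ler_sum => i _; rewrite mulr_sumr.
by apply: ler_sum => j _; rewrite ler_wpM2r // -expr2 sqr_ge0.
Qed.

End WeightedProduct.

(** Replaces the limit [t -> 0] in a directional derivative: at [t = -x / (2 (|c| + 1))] the term
    [t * c] is at most [-x / 2], too small to compensate a negative [x]. *)
Lemma ge0_of_small_steps (R : realType) (x c : R) :
  (forall t, 0 < t -> 0 <= x + t * c) -> 0 <= x.
Proof.
move=> h; rewrite leNgt; apply/negP => x0.
have d0 : 0 < `|c| + 1 by rewrite ltr_wpDl.
have := h (- x / (2 * (`|c| + 1))).
have -> : 0 < - x / (2 * (`|c| + 1)) by rewrite divr_gt0 ?oppr_gt0 ?mulr_gt0.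
move=> /(_ isT); apply/negP; rewrite -ltNge.
apply: (@le_lt_trans _ _ (x + - x / 2)); last by lra.
have -> : - x / (2 * (`|c| + 1)) * c = - x / 2 * (c / (`|c| + 1)).
  by field; rewrite gt_eqF.
rewrite lerD2l ler_piMr ?divr_ge0 ?oppr_ge0 ?(ltW x0) // ler_pdivrMr // mul1r.
by rewrite (le_trans (ler_norm _)) // lerDl.
Qed.

Section PenalizedLeastSquares.
Context {R : realType} {m n : nat}.
Context (w : 'M[R]_(m, n)) (k lam : R).
Context (k0 : 0 < k) (lam0 : 0 < lam) (kw : forall i j, k <= w i j).
Implicit Types A B D N : 'M[R]_(m, n).

(** The objective after completing the square: it differs from [objective] by the constant
    [wdot w A0 A0], with [N] the centered data matrix. *)
Definition penalized A0 N A :=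
  wdot w (A - A0) (A - A0) - 2 * mxdot N A + lam * nuclear_norm A.

(** Compare [A] with [A - t B] and let [t] go to 0; the penalty enters through the triangle
    inequality only, with no subdifferential. *)
Lemma penalized_first_order A0 N A B :
  is_argmin (penalized A0 N) A ->
  wdot w (A - A0) B <= mxdot N B + lam / 2 * nuclear_norm B.
Proof.
move=> amin; rewrite -subr_ge0.
suff h : 0 <= 2 * (mxdot N B + lam / 2 * nuclear_norm B - wdot w (A - A0) B) by lra.
apply: (@ge0_of_small_steps _ _ (wdot w B B)) => t t0.
have := amin (A + t *: - B); rewrite /penalized.
have -> : A + t *: - B - A0 = (A - A0) + t *: - B by rewrite addrAC.
have [D DE] : exists D, A - A0 = D by eexists.
rewrite DE.
have := nuclear_normD A (t *: - B); rewrite (nuclear_normZ _ (ltW t0)) nuclear_normN.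
rewrite !(wdotDl, wdotDr, wdotZl, wdotZr, wdotNl, wdotNr) mxdotDr mxdotZr mxdotNr.
rewrite (wdotC _ B D) -(ler_pM2l lam0) => h1 h2.
rewrite -(pmulr_rge0 _ t0); lra.
Qed.

Lemma penalized_cone A0 N A :
  (forall B, mxdot N B <= lam / 4 * nuclear_norm B) ->
  is_argmin (penalized A0 N) A ->
  k * nuclear_norm (A - A0) <= 24 * lam * (\rank A0)%:R.
Proof.
move=> hN amin; have [D DE'] : exists D, A - A0 = D by eexists.
have AE : A = A0 + D by rewrite -DE' addrC subrK.
rewrite DE'.
have [D1 [D2 [DE D1le D2le]]] := low_rank_split A0 D.
have := amin A0; rewrite /penalized subrr DE' AE.
have -> : wdot w 0 0 = 0 :> R by rewrite -(scale0r 0) wdotZl mul0r.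
rewrite mxdotDr => h.
have hD : mxdot N D <= lam / 4 * (nuclear_norm D1 + nuclear_norm D2).
  rewrite (le_trans (hN _)) // ler_pM2l ?divr_gt0 //.
  by rewrite DE nuclear_normD.
have hA : nuclear_norm A0 + nuclear_norm D2 - nuclear_norm D1 <= nuclear_norm (A0 + D).
  rewrite lerBlDr (le_trans D2le) //.
  have -> : A0 + D2 = A0 + D + - D1 by rewrite DE addrA addrAC addrK.
  by rewrite (le_trans (nuclear_normD _ _)) // nuclear_normN.
have kD := wdot_ge D kw.
have nD : nuclear_norm D <= nuclear_norm D1 + nuclear_norm D2.
  by rewrite DE nuclear_normD.
move: (nuclear_norm_ge0 D1) (nuclear_norm_ge0 D2) (frobenius_ge0 D) hD hA h D1le kD nD.
rewrite -sqr_frobenius -{2}(@sqr_sqrtr _ (\rank A0)%:R) ?ler0n //.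
have s0 : 0 <= Num.sqrt (\rank A0)%:R :> R by exact: sqrtr_ge0.
move: (frobenius_norm D) (nuclear_norm D) (nuclear_norm D1) (nuclear_norm D2) s0.
move: (nuclear_norm (A0 + D)) (nuclear_norm A0) (wdot w D D) (Num.sqrt _).
move: (mxdot N D) (mxdot N A0) => x y p q z s F d a b s0 a0 b0 F0 hD hA h D1le kD nD.
(* Here [a], [b] are the nuclear norms of [D1], [D2], [F] and [d] the Frobenius and nuclear norms of
   [D], and [s^2] the rank. Optimality gives [k F^2 <= lam/2 (a + b) + lam (a - b)], so [b <= 3 a].
   With [a <= 2 s F] this yields [k F <= 3 lam s] and [d <= 4 a <= 8 s F], whence 24. *)
have kF2 : k * F ^+ 2 + lam / 2 * b <= lam * (3 / 2) * a by have := ler_wpM2l (ltW lam0) hA => ?; nra.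
have ba : b <= 3 * a.
  rewrite -(ler_pM2l lam0); have := mulr_ge0 (ltW k0) (sqr_ge0 F) => ?; nra.
have kF : k * F <= 3 * lam * s.
  have [->|Fn0] := eqVneq F 0; first by rewrite mulr0; apply: mulr_ge0 => //; apply: mulr_ge0 => //; exact: ltW.
  have Fp : 0 < F by rewrite lt_def Fn0.
  rewrite -(ler_pM2r Fp); have := mulr_ge0 (ltW lam0) b0 => ?.
  have := ler_wpM2l (ltW lam0) D1le => ?; nra.
have kd : k * d <= k * (8 * s * F) by rewrite ler_pM2l //; nra.
have := ler_wpM2l s0 kF => ?; nra.
Qed.


Lemma penalized_bilinear_bound A0 N A (r : R) :
  (\rank A0)%:R <= r -> 0 < r ->
  (forall B D, mxdot B D = 0 ->
    `|wdot w B D| <= k / (11 * r) * (nuclear_norm B * nuclear_norm D)) ->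
  (forall B, mxdot N B <= lam / 4 * nuclear_norm B) ->
  is_argmin (penalized A0 N) A ->
  forall (u : 'cV[R]_m) (v : 'cV[R]_n), mxdot u u = 1 -> mxdot v v = 1 ->
    mxdot (A - A0) (u *m v^T) <= 6 * lam / k.
Proof.
move=> rkr r0 coh hN amin u v u1 v1; set B := u *m v^T.
have nB : nuclear_norm B <= 1 by exact: nuclear_rank1_le.
have BB : mxdot B B = 1.
  by rewrite mxdot_rank1 u1 v1 mulr1.
have cone := penalized_cone hN amin.
have first := penalized_first_order B amin.
have [D DE] : exists D, A - A0 = D by eexists.
rewrite DE in cone first *; set s := mxdot D B.
have [s0|s0] := leP s 0; first by rewrite (le_trans s0) // divr_ge0 ?mulr_ge0 ?ltW.
have sD : s <= nuclear_norm D.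
  rewrite (le_trans (mxdot_le_frobenius _ _)) // [frobenius_norm B]/frobenius_norm.
  by rewrite BB sqrtr1 mulr1 frobenius_le_nuclear.
pose D' := D - s *: B.
have D'B : mxdot D' B = 0 by rewrite mxdotBl mxdotZl BB mulr1 subrr.
have nD' : nuclear_norm D' <= 2 * nuclear_norm D.
  rewrite mulr_natl mulr2n (le_trans (nuclear_normD _ _)) // lerD2l.
  rewrite nuclear_normN (nuclear_normZ _ (ltW s0)) (le_trans _ sD) //.
  by rewrite ler_piMr // ltW.
have cDB := coh _ _ D'B.
have DB : wdot w D B = s * wdot w B B + wdot w D' B.
  by rewrite -wdotZl -wdotDl /D' addrC subrK.
have {}DB : s * wdot w B B + wdot w D' B <= wdot w D B by rewrite DB.
have kB := wdot_ge B kw; rewrite BB mulr1 in kB.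
have k11 : 0 <= k / (11 * r) by rewrite divr_ge0 ?mulr_ge0 ?ltW.
have c1 : `|wdot w D' B| <= k / (11 * r) * (2 * nuclear_norm D).
  rewrite (le_trans cDB) // ler_wpM2l // -[leRHS]mulr1.
  by rewrite ler_pM ?nuclear_norm_ge0.
(* Twice the cone bound 24, divided by 11. The first-order terms contribute [lam/4 + lam/2], and
   [3/4 + 48/11 < 6]. *)
have c2 : k / (11 * r) * (2 * nuclear_norm D) <= 48 / 11 * lam.
  have -> : k / (11 * r) * (2 * nuclear_norm D) = k * nuclear_norm D * (2 / (11 * r)).
    by field; rewrite gt_eqF.
  have -> : 48 / 11 * lam = 24 * lam * r * (2 / (11 * r)).
    by field; rewrite gt_eqF.
  rewrite ler_wpM2r //; first by rewrite divr_ge0 // mulr_ge0 // ltW.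
  rewrite (le_trans cone) //; by rewrite ler_wpM2l // mulr_ge0 // ltW.
have c3 : mxdot N B <= lam / 4.
  by rewrite (le_trans (hN _)) // ler_piMr // divr_ge0 // ltW.
have c4 : lam / 2 * nuclear_norm B <= lam / 2.
  by rewrite ler_piMr // divr_ge0 // ltW.
have c5 : - wdot w D' B <= 48 / 11 * lam.
  by rewrite (le_trans _ (le_trans c1 c2)) // -normrN ler_norm.
have c6 : s * k <= s * wdot w B B by rewrite ler_wpM2l // ltW.
have arith (a b c d e f : R) : a <= e + f -> c + b <= a -> e <= lam / 4 ->
  f <= lam / 2 -> - b <= 48 / 11 * lam -> d <= c -> d <= 6 * lam by nra.
rewrite ler_pdivlMr //.
exact: arith first DB c3 c4 c5 c6.
Qed.

(** The minimizer is compared with the midpoint of [A] and [B], where the parallelogram identity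
    gains a quarter of the weighted square of [B - A]. *)
Lemma penalized_strong_convexity A0 N A B :
  is_argmin (penalized A0 N) A ->
  penalized A0 N A + wdot w (B - A) (B - A) / 2 <= penalized A0 N B.
Proof.
move=> /(_ (2^-1 *: (A + B))); rewrite /penalized.
have -> : 2^-1 *: (A + B) - A0 = 2^-1 *: ((A - A0) + (B - A0)).
  by apply/matrixP => i j; rewrite !mxE; field.
have -> : B - A = (B - A0) - (A - A0).
  by apply/matrixP => i j; rewrite !mxE; ring.
have [X ->] : exists X, A - A0 = X by eexists.
have [Y ->] : exists Y, B - A0 = Y by eexists.
rewrite !(wdotZl, wdotZr, wdotDl, wdotDr, wdotNl, wdotNr) (wdotC _ Y X).
rewrite mxdotZr mxdotDr nuclear_normZ ?invr_ge0 // => h.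
have := ler_wpM2l (ltW lam0) (nuclear_normD A B) => ?.
lra.
Qed.

Lemma penalized_argmin_lipschitz A0 N N' A A' :
  is_argmin (penalized A0 N) A -> is_argmin (penalized A0 N') A' ->
  frobenius_norm (A - A') <= 2 / k * frobenius_norm (N - N').
Proof.
move=> /(penalized_strong_convexity A') h /(penalized_strong_convexity A) h'.
have hD : wdot w (A - A') (A - A') <= 2 * mxdot (N - N') (A - A').
  move: h h'; rewrite -(opprB A A') wdotNl wdotNr opprK /penalized.
  rewrite mxdotBl !mxdotBr; lra.
have := wdot_ge (A - A') kw; have := mxdot_le_frobenius (N - N') (A - A').
rewrite -sqr_frobenius; have := frobenius_ge0 (N - N'); have := frobenius_ge0 (A - A').
move: (frobenius_norm (A - A')) (frobenius_norm (N - N')) hD => x y hD x0 y0 h1 h2.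
rewrite mulrAC ler_pdivlMr // mulrC.
have [->|xn0] := eqVneq x 0; first by rewrite mulr0 mulr_ge0.
have xp : 0 < x by rewrite lt_def xn0.
by rewrite -(ler_pM2r xp); nra.
Qed.

End PenalizedLeastSquares.

(** * Trace exponential *)

Lemma expR_sub_le (R : realType) (a b : R) :
  `|expR a - expR b| <= `|a - b| * (expR a + expR b).
Proof.
wlog ab : a b / b <= a.
  move=> h; have [/h//|/ltW/h] := leP b a.
  by rewrite distrC (distrC b) (addrC (expR b)).
rewrite !ger0_norm ?subr_ge0 ?ler_expR // mulrDr.
have h : 1 + (b - a) <= expR (b - a) by exact: expR_ge1Dx.
have eE : expR b = expR a * expR (b - a) by rewrite -expRD addrC subrK.
have := ler_wpM2l (expR_ge0 a) h; rewrite -eE => h1.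
have : 0 <= (a - b) * expR b by rewrite mulr_ge0 ?subr_ge0 ?expR_ge0.
nra.
Qed.

Lemma expR_tangent (R : realType) (a b : R) :
  expR b + (a - b) * expR b <= expR a.
Proof.
have -> : expR a = expR b * expR (a - b) by rewrite -expRD addrC subrK.
have := ler_wpM2l (expR_ge0 b) (expR_ge1Dx (a - b)); nra.
Qed.

(** By the tangents at both ends, the remainder is at most [(a - b) (e^a - e^b)], hence at most
    [(a - b)^2] times the larger exponential. Bounding that by the sum leaves functions of [a] alone
    and of [b] alone, the form that transfers to two non-commuting matrices. *)
Lemma expR_tangent_gap (R : realType) (a b : R) :
  expR a <= expR b + (a - b) * expR b + (a - b) ^+ 2 * (expR a + expR b).
Proof.
have h1 := expR_tangent b a; have h2 := expR_tangent a b.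
have e0 := expR_ge0 a; have e1 := expR_ge0 b.
have [ab|/ltW ab] := leP b a.
  have := ler_wpM2l (_ : 0 <= a - b) h1; rewrite subr_ge0 => /(_ ab).
  have := mulr_ge0 (sqr_ge0 (a - b)) e1; nra.
have := ler_wpM2l (_ : 0 <= b - a) h2; rewrite subr_ge0 => /(_ ab).
have := mulr_ge0 (sqr_ge0 (a - b)) e0; nra.
Qed.

Section MatrixExponential.
Context {R : realType} {n : nat}.
Implicit Types (A B H U V X Y : 'M[R]_n) (a b c d : 'rV[R]_n).

Definition conj_diag U d : 'M[R]_n := U^T *m diag_mx d *m U.

(** Built on one chosen spectral decomposition, which [mx_expP] hands back for symmetric [A]. If
    there is none, the default pair gives the identity. *)
Definition mx_exp A : 'M[R]_n :=
  let Ud := xget (1%:M, 0) [set Ud : 'M[R]_n * 'rV[R]_n |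
    Ud.1 *m Ud.1^T = 1%:M /\ A = conj_diag Ud.1 Ud.2] in
  conj_diag Ud.1 (map_mx expR Ud.2).

Lemma mx_expP A : A^T = A -> exists U d,
  [/\ U *m U^T = 1%:M, A = conj_diag U d &
      mx_exp A = conj_diag U (map_mx expR d)].
Proof.
move=> sA; rewrite /mx_exp; case: xgetP => [[U d] _ /= [UU AE]|h].
  by exists U, d.
by have [Ud [h1 h2]] := real_spectral sA; case: (h Ud).
Qed.

Lemma mxdot_orthogonal U V X Y : U *m U^T = 1%:M -> V *m V^T = 1%:M ->
  mxdot X Y = mxdot (U *m X *m V^T) (U *m Y *m V^T).
Proof.
move=> UU VV; rewrite [RHS]mxdot_mulr trmxK -(mulmxA (U *m Y)) (mulmx1C VV) mulmx1.
by rewrite mxdot_mull mulmxA (mulmx1C UU) mul1mx.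
Qed.

(** With rows indexed by one eigenbasis and columns by another, a function of the second matrix on
    the right acts by [c_j]; in [mxdot_conj_diagl] a function of the first on the left acts by
    [c_i]. *)
Lemma mxdot_conj_diagr U V X Y c : U *m U^T = 1%:M -> V *m V^T = 1%:M ->
  mxdot X (Y *m conj_diag V c) =
  \sum_i \sum_j (U *m X *m V^T) i j * (U *m Y *m V^T) i j * c 0 j.
Proof.
move=> UU VV; rewrite (mxdot_orthogonal _ _ UU VV) mxdotE.
have -> : U *m (Y *m conj_diag V c) *m V^T = U *m Y *m V^T *m diag_mx c.
  by rewrite /conj_diag -!mulmxA VV mulmx1.
do 2!apply: eq_bigr => ? _; rewrite mul_mx_diag [X in _ * X]mxE; exact: mulrA.
Qed.

Lemma mxdot_conj_diagl U V X Y c : U *m U^T = 1%:M -> V *m V^T = 1%:M ->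
  mxdot X (conj_diag U c *m Y) =
  \sum_i \sum_j (U *m X *m V^T) i j * (U *m Y *m V^T) i j * c 0 i.
Proof.
move=> UU VV; rewrite (mxdot_orthogonal _ _ UU VV) mxdotE.
have -> : U *m (conj_diag U c *m Y) *m V^T = diag_mx c *m (U *m Y *m V^T).
  by rewrite /conj_diag !mulmxA UU mul1mx.
do 2!apply: eq_bigr => ? _; rewrite mul_diag_mx [X in _ * X]mxE; by rewrite mulrCA mulrC.
Qed.

(* Both spectral bases at once: in the bases diagonalizing [A] and [B], the
   entries of [A - B] are those of the change of basis times [a_i - b_j]. *)
Lemma conj_diagB U V a b i j : U *m U^T = 1%:M -> V *m V^T = 1%:M ->
  (U *m (conj_diag U a - conj_diag V b) *m V^T) i j =
  (a 0 i - b 0 j) * (U *m 1%:M *m V^T) i j.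
Proof.
move=> UU VV; rewrite mulmxBr mulmxBl mulmx1.
have -> : U *m conj_diag U a *m V^T = diag_mx a *m (U *m V^T).
  by rewrite /conj_diag !mulmxA UU mul1mx.
have -> : U *m conj_diag V b *m V^T = U *m V^T *m diag_mx b.
  by rewrite /conj_diag -!mulmxA VV mulmx1.
by rewrite mul_diag_mx mul_mx_diag !mxE; ring.
Qed.

(** Klein's inequality for the exponential: the [(i, j)] term is the scalar tangent inequality at
    [(a_i, b_j)] times the squared overlap of the two eigenvectors. *)
Lemma trace_exp_tangent A B : A^T = A -> B^T = B ->
  \tr (mx_exp B) + mxdot (A - B) (mx_exp B) <= \tr (mx_exp A).
Proof.
move=> /mx_expP[U [a [UU -> ->]]] /mx_expP[V [b [VV -> ->]]].
have trE Z : \tr Z = mxdot 1%:M Z by rewrite /mxdot trmx1 mul1mx.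
rewrite !trE -[conj_diag V (map_mx expR b)]mul1mx !(mxdot_conj_diagr _ _ _ UU VV).
rewrite -[conj_diag U (map_mx expR a)]mulmx1 !(mxdot_conj_diagl _ _ _ UU VV).
rewrite -big_split /=; apply: ler_sum => i _; rewrite -big_split /=.
apply: ler_sum => j _; rewrite conj_diagB // ![map_mx _ _ _ _]mxE.
have := expR_tangent (a 0 i) (b 0 j); set o := (_ *m _) i j => h.
have := ler_wpM2l (sqr_ge0 o) h; nra.
Qed.

Lemma trace_exp_gap A B : A^T = A -> B^T = B ->
  \tr (mx_exp A) <= \tr (mx_exp B) + mxdot (A - B) (mx_exp B) +
    (mxdot (A - B) (mx_exp A *m (A - B)) + mxdot (A - B) ((A - B) *m mx_exp B)).
Proof.
move=> /mx_expP[U [a [UU -> ->]]] /mx_expP[V [b [VV -> ->]]].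
have trE Z : \tr Z = mxdot 1%:M Z by rewrite /mxdot trmx1 mul1mx.
rewrite !trE !(mxdot_conj_diagl _ _ _ UU VV) !(mxdot_conj_diagr _ _ _ UU VV).
rewrite -[X in mxdot _ X + _ + _]mul1mx -[X in _ + mxdot _ X + _]mul1mx.
rewrite -[X in mxdot _ X <= _]mulmx1 !(mxdot_conj_diagr _ _ _ UU VV).
rewrite !(mxdot_conj_diagl _ _ _ UU VV) -!big_split /=.
apply: ler_sum => i _; rewrite -!big_split /=.
apply: ler_sum => j _; rewrite !conj_diagB // ![map_mx _ _ _ _]mxE.
have := expR_tangent_gap (a 0 i) (b 0 j); set o := (_ *m _) i j => h.
have := ler_wpM2l (sqr_ge0 o) h; nra.
Qed.

Lemma mxdot_exp_ge0 A X : A^T = A -> 0 <= mxdot X (mx_exp A *m X).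
Proof.
move=> /mx_expP[U [a [UU _ ->]]]; rewrite (mxdot_conj_diagl _ _ _ UU UU).
do 2!apply: sumr_ge0 => ? _; rewrite -expr2 mulr_ge0 ?sqr_ge0 //.
by rewrite mxE expR_ge0.
Qed.

Lemma trace_exp_ge_eigen A : A^T = A -> exists U a, [/\ U *m U^T = 1%:M,
  A = conj_diag U a & forall i, expR (a 0 i) <= \tr (mx_exp A)].
Proof.
move=> /mx_expP[U [a [UU AE ->]]]; exists U, a; split=> // i.
rewrite /conj_diag mxtrace_mulC mulmxA UU mul1mx mxtrace_diag (bigD1 i) //= mxE.
by rewrite lerDl sumr_ge0 // => j _; rewrite mxE expR_ge0.
Qed.

Lemma quadratic_le_of_trace_exp A L (x : 'cV[R]_n) : A^T = A ->
  \tr (mx_exp A) <= expR L -> mxdot x (A *m x) <= L * mxdot x x.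
Proof.
move=> sA trL; have [U [a [UU AE ale]]] := trace_exp_ge_eigen sA; rewrite {1}AE.
have -> : mxdot x x = mxdot (U *m x) (U *m x).
  by rewrite [RHS]mxdot_mull mulmxA (mulmx1C UU) mul1mx.
have -> : mxdot x (conj_diag U a *m x) = mxdot (U *m x) (diag_mx a *m (U *m x)).
  by rewrite [RHS]mxdot_mull /conj_diag !mulmxA.
move: (U *m x) => z.
rewrite !mxdot_cV mulr_sumr; apply: ler_sum => i _; rewrite mul_diag_mx mxE.
rewrite mulrCA ler_wpM2r -?expr2 ?sqr_ge0 //.
by rewrite -ler_expR (le_trans (ale i)).
Qed.

Lemma mxdot_exp_frobenius A X : A^T = A ->
  `|mxdot X (mx_exp A)| <= frobenius_norm X * \tr (mx_exp A).
Proof.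
move=> /mx_expP[U [a [UU _ ->]]].
have -> : \tr (conj_diag U (map_mx expR a)) = \sum_i expR (a 0 i).
  rewrite /conj_diag mxtrace_mulC mulmxA UU mul1mx mxtrace_diag.
  by apply: eq_bigr => i _; rewrite mxE.
have -> : mxdot X (conj_diag U (map_mx expR a)) =
    \sum_i expR (a 0 i) * (U *m X *m U^T) i i.
  rewrite (mxdot_orthogonal _ _ UU UU) /conj_diag !mulmxA UU mul1mx -(mulmxA (diag_mx _)) UU.
  rewrite mulmx1 mxdotE; apply: eq_bigr => i _; rewrite (bigD1 i) //= big1.
    by rewrite [X in _ * X]mxE eqxx mulr1n [map_mx _ _ _ _]mxE addr0 mulrC.
  by move=> j ji; rewrite [X in _ * X]mxE eq_sym (negbTE ji) mulr0n mulr0.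
have -> : frobenius_norm X = frobenius_norm (U *m X *m U^T).
  by rewrite /frobenius_norm -(mxdot_orthogonal X X UU UU).
rewrite (le_trans (ler_norm_sum _ _ _)) // mulr_sumr; apply: ler_sum => i _.
rewrite normrM ger0_norm ?expR_ge0 // mulrC ler_wpM2r ?expR_ge0 //.
rewrite -(@ler_pXn2r _ 2) ?nnegrE ?frobenius_ge0 // real_normK ?num_real // sqr_frobenius mxdotE.
rewrite (bigD1 i) //= (bigD1 i) //= -expr2 -addrA lerDl addr_ge0 //.
  by apply: sumr_ge0 => j _; rewrite -expr2 sqr_ge0.
by do 2!apply: sumr_ge0 => ? _; rewrite -expr2 sqr_ge0.
Qed.

Section Tripotent.
Context {X : 'M[R]_n} (sX : X^T = X) (X3 : X *m X *m X = X).

Let tripotent_traces M : [/\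
  mxdot 1%:M (M *m (X *m X)) = mxdot X (M *m X),
  mxdot 1%:M ((X *m X) *m M) = mxdot X (M *m X),
  mxdot X (X *m M) = mxdot X (M *m X),
  mxdot (X *m X) (M *m (X *m X)) = mxdot X (M *m X) &
  mxdot (X *m X) ((X *m X) *m M) = mxdot X (M *m X)].
Proof.
rewrite /mxdot trmx1 !mul1mx trmx_mul !sX.
have E : \tr (X *m X *m M) = \tr (X *m (M *m X)).
  by rewrite -mulmxA mxtrace_mulC mulmxA.
split => //.
- by rewrite mulmxA mxtrace_mulC.
- by rewrite mulmxA.
- have -> : X *m X *m (M *m (X *m X)) = X *m (X *m M *m X *m X) by rewrite !mulmxA.
  have X3' : X *m (X *m X) = X by rewrite mulmxA.
  by rewrite mxtrace_mulC -!mulmxA X3'.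
by rewrite -E !mulmxA X3.
Qed.

(** Let [o], [x], [z] be the coordinates of [1], [X], [X^2] in the two eigenbases. Tripotency writes
    each of the two traces both with weights [o z] and, doubled, with weights [x^2 + z^2]. As
    [y x_ij = (a_i - b_j) o_ij], the difference of the [o z] forms is at most [|y|] times the sum of
    the traces; [|y| <= 1/2] then gives the factor 3. *)
Lemma tripotent_exp_step H y : H^T = H -> `|y| <= 2^-1 ->
  mxdot X (mx_exp (H + y *: X) *m X) <= 3 * mxdot X (mx_exp H *m X).
Proof.
move=> sH y2; have sK : (H + y *: X)^T = H + y *: X by rewrite linearD linearZ /= sH sX.
have gH0 := mxdot_exp_ge0 X sH; have gK0 := mxdot_exp_ge0 X sK.
suff gle : mxdot X (mx_exp (H + y *: X) *m X) - mxdot X (mx_exp H *m X) <=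
    `|y| * (mxdot X (mx_exp (H + y *: X) *m X) + mxdot X (mx_exp H *m X)).
  have := ler_wpM2r (addr_ge0 gK0 gH0) y2; lra.
have KHE : H + y *: X - H = y *: X by rewrite addrC addKr.
move: (mx_expP sK) (mx_expP sH) => [U [a [UU KE eK]]] [V [b [VV HE eH]]].
have [k1 _ _ k4 _] := tripotent_traces (mx_exp (H + y *: X)).
have [_ h2 h3 _ h5] := tripotent_traces (mx_exp H).
pose o := U *m 1%:M *m V^T; pose x := U *m X *m V^T; pose z := U *m (X *m X) *m V^T.
have xE i j : y * x i j = (a 0 i - b 0 j) * o i j.
  rewrite -(conj_diagB _ _ _ _ UU VV) -KE -HE KHE /x.
  by rewrite -scalemxAr -scalemxAl [RHS]mxE.
have KK : 2 * mxdot X (mx_exp (H + y *: X) *m X) =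
    \sum_i \sum_j (x i j ^+ 2 + z i j ^+ 2) * expR (a 0 i).
  rewrite mulr_natl mulr2n -{2}k4 eK !(mxdot_conj_diagl _ _ _ UU VV) -big_split /=.
  apply: eq_bigr => i _; rewrite -big_split /=; apply: eq_bigr => j _.
  by rewrite ![map_mx _ _ _ _]mxE /x /z; ring.
have HH : 2 * mxdot X (mx_exp H *m X) =
    \sum_i \sum_j (x i j ^+ 2 + z i j ^+ 2) * expR (b 0 j).
  rewrite mulr_natl mulr2n -{2}h5 -h3 eH !(mxdot_conj_diagr _ _ _ UU VV) -big_split /=.
  apply: eq_bigr => i _; rewrite -big_split /=; apply: eq_bigr => j _.
  by rewrite ![map_mx _ _ _ _]mxE /x /z; ring.
rewrite -(ler_pM2l (ltr0n _ 2 : 0 < 2)) mulrCA [in leRHS]mulrDr KK HH.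
rewrite -{1}k1 -h2 eK eH (mxdot_conj_diagl _ _ _ UU VV) (mxdot_conj_diagr _ _ _ UU VV).
rewrite -!big_split -sumrB !mulr_sumr /=; apply: ler_sum => i _.
rewrite -big_split -sumrB !mulr_sumr /=; apply: ler_sum => j _.
rewrite ![map_mx _ _ _ _]mxE -/o -/z -mulrBr -mulrDr.
apply: le_trans (ler_norm _) _; rewrite !normrM (mulrAC `|o i j|).
have ole : `|o i j| * `|expR (a 0 i) - expR (b 0 j)| <=
    `|y| * `|x i j| * (expR (a 0 i) + expR (b 0 j)).
  rewrite -(normrM y) xE normrM [X in _ <= X * _]mulrC -mulrA ler_wpM2l //.
  exact: expR_sub_le.
have := ler_wpM2r (normr_ge0 (z i j)) ole.
have xz : 2 * (`|x i j| * `|z i j|) <= x i j ^+ 2 + z i j ^+ 2.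
  by have := sqr_ge0 (`|x i j| - `|z i j|); rewrite sqrrB !real_normK ?num_real //; lra.
have e0 : 0 <= `|y| * (expR (a 0 i) + expR (b 0 j)).
  by rewrite mulr_ge0 ?addr_ge0 ?expR_ge0.
have := ler_wpM2l e0 xz; rewrite ger0_norm //; nra.
Qed.

(* Iterates [tripotent_exp_step] along steps of length at most 1/2. *)
Lemma tripotent_exp_growth H y : H^T = H ->
  mxdot X (mx_exp (H + y *: X) *m X) <=
  expR (2 + 4 * `|y|) * mxdot X (mx_exp H *m X).
Proof.
move=> sH; have := mxdot_exp_ge0 X sH; set g := mxdot X _ => g0.
have steps k s : `|s| <= 2^-1 ->
    mxdot X (mx_exp (H + (k%:R * s) *: X) *m X) <= 3 ^+ k * g.
  move=> s2; elim: k => [|k IHk]; first by rewrite mul0r scale0r addr0 expr0 mul1r.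
  have -> : H + (k.+1%:R * s) *: X = H + (k%:R * s) *: X + s *: X.
    by rewrite -natr1 mulrDl mul1r scalerDl addrA.
  apply: le_trans (tripotent_exp_step _ _) _ => //.
    by rewrite linearD linearZ /= sH sX.
  by rewrite exprS -mulrA ler_pM2l.
(* Then [|y| / k <= 1/2] and [k <= 2 |y| + 1], so [3^k <= e^(2k) <= e^(2 + 4|y|)]. *)
pose k := (Num.truncn (2 * `|y|)).+1.
have k1 : 2 * `|y| < k%:R by exact: truncnS_gt.
have k2 : k%:R <= 2 * `|y| + 1 by rewrite /k -natr1 lerD2r truncn_le // mulr_ge0.
have k0 : 0 < k%:R :> R by rewrite ltr0n.
have kE : k%:R * (y / k%:R) = y by rewrite mulrC divfK ?gt_eqF.
have := steps k (y / k%:R); rewrite kE => h.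
apply: le_trans (h _) _.
  rewrite normrM normfV (ger0_norm (ltW k0)) ler_pdivrMr //.
  lra.
rewrite ler_wpM2r //.
have e2 : 3 <= expR 2 :> R by have := expR_ge1Dx (2 : R); lra.
apply: (@le_trans _ _ (expR 2 ^+ k)).
  by apply: lerXn2r; rewrite ?nnegrE ?expR_ge0.
rewrite -expRM_natr ler_expR; lra.
Qed.

Lemma trace_exp_tripotent_le H y : H^T = H ->
  \tr (mx_exp (H + y *: X)) <= \tr (mx_exp H) + y * mxdot X (mx_exp H) +
    2 * y ^+ 2 * expR (2 + 4 * `|y|) * mxdot X (mx_exp H *m X).
Proof.
move=> sH; have sK : (H + y *: X)^T = H + y *: X by rewrite linearD linearZ /= sH sX.
have KHE : H + y *: X - H = y *: X by rewrite addrC addKr.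
apply: le_trans (trace_exp_gap sK sH) _; rewrite KHE mxdotZl lerD2l.
rewrite -scalemxAl -scalemxAr !mxdotZl !mxdotZr.
have [_ _ -> _ _] := tripotent_traces (mx_exp H).
have := mxdot_exp_ge0 X sH; have := tripotent_exp_growth y sH.
move: (mxdot X _) (mxdot X _) => g1 g g1le g0.
have e1 : 1 <= expR (2 + 4 * `|y|) by rewrite -expR0 ler_expR addr_ge0 ?mulr_ge0.
have h1 := ler_wpM2l (sqr_ge0 y) g1le.
have h2 := ler_wpM2l (sqr_ge0 y) (ler_wpM2r g0 e1).
nra.
Qed.

End Tripotent.

End MatrixExponential.

(** * Symmetric dilation of rectangular matrices *)

Section Dilation.
Context {R : realType} {m n : nat}.
Implicit Types (N : 'M[R]_(m, n)) (G : 'M[R]_(m + n)).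

Definition dilation N : 'M[R]_(m + n) := block_mx 0 N N^T 0.

Definition trace_exp N : R := \tr (mx_exp (dilation N)).

Lemma dilation_sym N : (dilation N)^T = dilation N.
Proof. by rewrite /dilation tr_block_mx !trmx0 trmxK. Qed.

Lemma dilationD N N' : dilation (N + N') = dilation N + dilation N'.
Proof. by rewrite /dilation add_block_mx !addr0 linearD. Qed.

Lemma dilationZ a N : dilation (a *: N) = a *: dilation N.
Proof. by rewrite /dilation scale_block_mx !scaler0 linearZ. Qed.

Lemma dilationB N N' : dilation (N - N') = dilation N - dilation N'.
Proof. by rewrite -scaleN1r dilationD dilationZ scaleN1r. Qed.

Lemma dilation0 : dilation 0 = 0.
Proof. by rewrite -(scale0r 0) dilationZ scale0r. Qed.

Lemma dilation_sqr N : dilation N *m dilation N = block_mx (N *m N^T) 0 0 (N^T *m N).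
Proof. by rewrite /dilation mulmx_block !mulmx0 !mul0mx !addr0 !add0r. Qed.

Lemma dilation_tripotent N : N *m N^T *m N = N ->
  dilation N *m dilation N *m dilation N = dilation N.
Proof.
move=> NN; rewrite dilation_sqr /dilation mulmx_block !mulmx0 !mul0mx !addr0 !add0r.
have NT : N^T *m N *m N^T = N^T by rewrite -[in RHS]NN !trmx_mul trmxK mulmxA.
by rewrite NN NT.
Qed.

Lemma mxdot_dilation N G : mxdot (dilation N) G = mxdot N (ursubmx G + (dlsubmx G)^T).
Proof.
rewrite mxdotDr -[X in _ = _ + X]mxdot_tr trmxK -[in LHS](submxK G) /dilation.
rewrite /mxdot tr_block_mx mulmx_block !trmx0 !mul0mx trmxK !addr0 !add0r.
by rewrite mxtrace_block addrC.
Qed.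

Lemma mxdot_dilation_sqr N N' : mxdot (dilation N) (dilation N') = 2 * mxdot N N'.
Proof.
rewrite mxdot_dilation /dilation block_mxKur block_mxKdl trmxK mxdotDr.
by rewrite mulr_natl mulr2n.
Qed.

Lemma frobenius_dilation_le N : frobenius_norm (dilation N) <= 2 * frobenius_norm N.
Proof.
rewrite -(@ler_pXn2r _ 2) ?nnegrE ?mulr_ge0 ?frobenius_ge0 // exprMn !sqr_frobenius.
by rewrite mxdot_dilation_sqr ler_wpM2r ?mxdot_ge0 // ler_eXnr // ler1n.
Qed.

(** Test the dilation on the stacked vector [(u, v)]: its squared norm is 2 and its quadratic form
    is twice [u^T N v]. *)
Lemma bilinear_le_of_trace_exp N (L : R) (u : 'cV[R]_m) (v : 'cV[R]_n) :
  trace_exp N <= expR L -> mxdot u u = 1 -> mxdot v v = 1 ->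
  mxdot N (u *m v^T) <= L.
Proof.
move=> NL u1 v1; have := quadratic_le_of_trace_exp (col_mx u v) (dilation_sym N) NL.
have dotE (x y : 'cV[R]_m) (z t : 'cV[R]_n) :
    mxdot (col_mx x z) (col_mx y t) = mxdot x y + mxdot z t.
  by rewrite /mxdot tr_col_mx mul_row_col linearD.
rewrite /dilation mul_block_col !mul0mx add0r addr0 !dotE u1 v1.
rewrite -mxdot_mull (mxdotC (N *m v)).
have -> : mxdot N (u *m v^T) = mxdot u (N *m v) by rewrite mxdotC mxdot_mulr trmxK.
rewrite -!mulr2n -mulr_natr -[_ *+ 2]mulr_natr mul1r.
by rewrite ler_pM2r.
Qed.

Lemma trace_exp_ge0 N : 0 <= trace_exp N.
Proof.
rewrite /trace_exp; case: (m + n)%N (dilation N) (dilation_sym N) => [|k] D sD.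
  by rewrite /mxtrace big_ord0.
have [U [a [_ _ /(_ 0)]]] := trace_exp_ge_eigen sD.
by apply: le_trans; exact: expR_ge0.
Qed.

Lemma trace_exp0 : trace_exp 0 = (m + n)%:R.
Proof.
rewrite /trace_exp dilation0; have := @mx_expP R (m + n) 0.
rewrite trmx0 => /(_ erefl) [U [a [UU U0 ->]]].
rewrite /conj_diag mxtrace_mulC mulmxA UU mul1mx mxtrace_diag.
have a0 : diag_mx a = 0.
  have <- : U *m conj_diag U a *m U^T = diag_mx a.
    by rewrite /conj_diag !mulmxA UU mul1mx -mulmxA UU mulmx1.
  by rewrite -U0 mulmx0 mul0mx.
rewrite (eq_bigr (fun=> 1)) ?sumr_const ?card_ord // => i _.
have := congr1 (fun M : 'M[R]_(m + n) => M i i) a0.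
by rewrite !mxE eqxx mulr1n => ->; exact: expR0.
Qed.

Lemma trace_exp_tangent_dilation N N' :
  trace_exp N' + mxdot (dilation (N - N')) (mx_exp (dilation N')) <= trace_exp N.
Proof. by rewrite dilationB; exact: trace_exp_tangent (dilation_sym _) (dilation_sym _). Qed.

Lemma mxdot_continuous (C : 'M[R]_(m, n)) : continuous (fun N => mxdot N C).
Proof.
have -> : (fun N => mxdot N C) = (fun N => \sum_i \sum_j N i j * C i j).
  by apply/funext => N; rewrite mxdotE.
apply: (continuous_big add_continuous) => i _.
apply: (continuous_big add_continuous) => j _ N.
exact: (cvgMr_tmp (f := fun M : 'M[R]_(m, n) => M i j) (@coord_continuous R m n i j N)).
Qed.

(* [trace_exp] is a supremum of affine functions by [trace_exp_tangent]. *)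
Lemma trace_exp_open c : open [set N | c < trace_exp N].
Proof.
pose O N' := [set N | c < trace_exp N' + mxdot (dilation (N - N')) (mx_exp (dilation N'))].
have -> : [set N | c < trace_exp N] = \bigcup_N' O N'.
  apply/seteqP; split => N /=; last first.
    by move=> [N' _] /lt_le_trans; apply; exact: trace_exp_tangent_dilation.
  by exists N => //; rewrite /O /= subrr dilation0 mxdot0l addr0.
apply: bigcup_open => N' _.
pose f (N : 'M[R]_(m, n)) : R := trace_exp N' + mxdot (dilation (N - N')) (mx_exp (dilation N')).
have fE : f = (fun N => (trace_exp N' - mxdot N' (ursubmx (mx_exp (dilation N')) +
    (dlsubmx (mx_exp (dilation N')))^T)) + mxdot N (ursubmx (mx_exp (dilation N')) +
    (dlsubmx (mx_exp (dilation N')))^T)).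
  by apply/funext => N; rewrite /f mxdot_dilation mxdotBl -addrA (addrC (- _)).
have cf : continuous f.
  rewrite fE; move=> N; apply: (@continuousD _ _ _ (cst _) (fun N => mxdot N _) N).
    exact: cst_continuous.
  exact: mxdot_continuous.
apply: (open_comp (f := f) (D := [set x | c < x])) => [N _|]; [exact: cf|exact: open_gt].
Qed.

End Dilation.

(** * Measurability and independence *)

Section MatrixMeasurability.
Context {R : realType} {m n : nat}.

Lemma open_matrix_measurable (U : set 'M[R]_(m, n)) : open U -> measurable U.
Proof. by move=> oU; apply: sub_sigma_algebra. Qed.

Lemma matrix_entry_measurable (i : 'I_m) (j : 'I_n) :
  measurable_fun [set: 'M[R]_(m, n)] (fun M : 'M[R]_(m, n) => M i j).
Proof.
apply: (measurability _ (RGenOInfty.measurableE R)) => _ [_ [x ->] <-].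
rewrite setTI; apply: open_matrix_measurable.
apply: (open_comp (f := fun M : 'M[R]_(m, n) => M i j)) => [M _|].
  exact: (@coord_continuous R m n i j M).
by rewrite set_itvE; exact: open_gt.
Qed.

(* An open set of matrices is a countable union of rational boxes. *)
Lemma measurable_preimage_open d (T : measurableType d) (f : T -> 'M[R]_(m, n))
    (U : set 'M[R]_(m, n)) :
  (forall i j, measurable_fun [set: T] (fun t => f t i j)) ->
  open U -> measurable (f @^-1` U).
Proof.
move=> mf oU; pose box (p : 'M[rat]_(m, n) * nat) : set 'M[R]_(m, n) :=
  [set M | forall i j, `|M i j - ratr (p.1 i j)| < p.2.+1%:R^-1].
pose F p := if `[< box p `<=` U >] then f @^-1` box p else set0.
have -> : f @^-1` U = \bigcup_p F p.
  apply/seteqP; split => [t /= Ut|t [p _]]; last first.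
    by rewrite /F; case: asboolP => // pU /pU.
  have /nbhs_ballP[e e0 eU] : nbhs (f t) U by exact: open_nbhs_nbhs.
  have [k ke] : exists k, k.+1%:R^-1 < e / 2 :> R.
    exists (Num.truncn (e / 2)^-1); rewrite invf_plt ?posrE ?divr_gt0 //.
    exact: truncnS_gt.
  have q i j : {q : rat | `|f t i j - ratr q| < k.+1%:R^-1}.
    apply: cid; have [|q] := @rat_in_itvoo R (f t i j - k.+1%:R^-1) (f t i j + k.+1%:R^-1).
      by rewrite ltrBlDr -addrA ltrDl addr_gt0 ?invr_gt0 ?ltr0n.
    by rewrite in_itv /= => qI; exists q; rewrite ltr_distlC.
  pose Q : 'M[rat]_(m, n) := \matrix_(i, j) sval (q i j).
  exists (Q, k) => //; rewrite /F; case: asboolP => [_ i j|nU].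
    by rewrite /= mxE; exact: svalP (q i j).
  exfalso; apply: nU => M /= MQ; apply: eU; split => // i j.
  rewrite /ball /= (le_lt_trans (ler_distD (ratr (Q i j)) _ _)) //.
  rewrite [ltRHS]splitr ltrD //; last by rewrite distrC (lt_trans (MQ i j)).
  by rewrite (lt_trans _ ke) // mxE; exact: svalP (q i j).
apply: countable_bigcupT_measurable => [|p].
  exact: countableP.
rewrite /F; case: asboolP => // _.
have -> : f @^-1` box p = \bigcap_(ij in [set: 'I_m * 'I_n])
    ((fun t => `|f t ij.1 ij.2 - ratr (p.1 ij.1 ij.2)|) @^-1` `]-oo, p.2.+1%:R^-1[).
  apply/seteqP; split => [t /= h [i j] _ /=|t /= h i j]; first by rewrite in_itv /= h.
  by have := h (i, j) I; rewrite /= in_itv.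
apply: fin_bigcap_measurable => // -[i j] _ /=; rewrite -[X in measurable X]setTI.
have : measurable_fun setT (fun t => `|f t i j - ratr (p.1 i j)|).
  have mB : measurable_fun setT (fun t => f t i j - ratr (p.1 i j)).
    exact: measurable_funB (mf i j) (measurable_cst _).
  exact: (measurableT_comp (@normr_measurable R setT) mB).
by apply => //; exact: measurable_itv.
Qed.

Lemma measurable_trace_exp d (T : measurableType d) (f : T -> 'M[R]_(m, n)) :
  (forall i j, measurable_fun [set: T] (fun t => f t i j)) ->
  measurable_fun [set: T] (fun t => trace_exp (f t)).
Proof.
move=> mf; apply: (measurability _ (RGenOInfty.measurableE R)) => _ [_ [x ->] <-].
rewrite setTI set_itvE; apply: (measurable_preimage_open (U := [set N | x < trace_exp N])) => //.
exact: trace_exp_open.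
Qed.

End MatrixMeasurability.

Section Independence.
Local Open Scope ereal_scope.
Context {d : measure_display} {T : measurableType d} {R : realType}.
Context (P : probability T R).

(** Independence makes the law of [(f, g)] a product. The iterated integral is written with [P]
    twice, so that the inner one is an expectation with the value of [f] frozen. *)
Lemma independent2_tonelli d1 d2 (T1 : measurableType d1) (T2 : measurableType d2)
    (f : T -> T1) (g : T -> T2) (F : T1 * T2 -> \bar R) :
  measurable_fun [set: T] f -> measurable_fun [set: T] g -> independent2 P f g ->
  measurable_fun [set: T1 * T2] F -> (forall z, 0 <= F z) ->
  \int[P]_w F (f w, g w) = \int[P]_w \int[P]_w' F (f w, g w').
Proof.
move=> mf mg indep mF F0.
pose f' : {mfun T >-> T1} := HB.pack f (isMeasurableFun.Build _ _ _ _ _ mf).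
pose g' : {mfun T >-> T2} := HB.pack g (isMeasurableFun.Build _ _ _ _ _ mg).
have mfg : measurable_fun [set: T] (fun w => (f w, g w)).
  exact: measurable_fun_pair.
pose fg : {mfun T >-> (T1 * T2)%type} :=
  HB.pack (fun w => (f w, g w)) (isMeasurableFun.Build _ _ _ _ _ mfg).
transitivity (\int[distribution P fg]_z F z).
  by rewrite ge0_integral_distribution.
have fgE : forall A, measurable A ->
    (distribution P f' \x distribution P g') A = distribution P fg A.
  by apply: product_measure_unique => B C mB mC; exact: indep.
rewrite (@eq_measure_integral _ _ _ _ (distribution P f' \x distribution P g')); last first.
  by move=> A mA _; rewrite /= fgE.
rewrite fubini_tonelli1 // ge0_integral_distribution //=; last first.
- by move=> x; apply: integral_ge0 => y _.
- exact: measurable_fun_fubini_tonelli_F.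
apply: eq_integral => w _; rewrite /fubini_F ge0_integral_distribution //.
exact: (measurableT_comp mF (pair1_measurable (f w))).
Qed.

End Independence.

(** * Independence of an observation from the preceding ones *)

Section Past.
Context {d d' : measure_display} {T : measurableType d} {T' : measurableType d'}.
Context {R : realType} {n : nat} (P : probability T R) (W : 'I_n -> T -> T').
Context (mW : forall i, measurable_fun [set: T] (W i)).
Context (indW : mutually_independent P W) (l : 'I_n).

(** A pi-system generating the past of [l]. Giving [T] the sigma-algebra it generates turns the past
    into a random variable, the identity map. *)
Definition past_cylinders : set (set T) :=
  [set A | exists2 B : 'I_n -> set T', forall i, measurable (B i) &
    A = \bigcap_(i in [set i : 'I_n | (i < l)%N]) (W i @^-1` B i)].

Let measurable_preimage i B : measurable B -> measurable (W i @^-1` B).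
Proof. by move=> mB; rewrite -[X in measurable X]setTI; exact: mW. Qed.

Lemma measurable_past_cylinders : past_cylinders `<=` measurable.
Proof.
move=> _ [B mB ->]; apply: fin_bigcap_measurable => // i _.
exact: measurable_preimage.
Qed.

Lemma measurable_past (i : 'I_n) : (i < l)%N ->
  measurable_fun [set: g_sigma_algebraType past_cylinders] (W i).
Proof.
move=> il _ B mB; rewrite setTI; apply: sub_sigma_algebra.
exists (fun k => if k == i then B else setT) => [k|]; first by case: eqP.
apply/seteqP; split => [w wB k _|w /(_ i il)] /=; last by rewrite eqxx.
by case: eqP => // ->.
Qed.

Lemma measurable_fun_past :
  measurable_fun [set: T] (fun w => w : g_sigma_algebraType past_cylinders).
Proof.
move=> _ A mA; rewrite setTI preimage_id; move: mA.
apply: smallest_sub; first exact: sigma_algebra_measurable.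
exact: measurable_past_cylinders.
Qed.

(** The finite measures [A -> P(A and W_l in C)] and [A -> P(W_l in C) P(A)] agree on the pi-system
    of cylinders, hence on the past. *)
Lemma independent2_past :
  independent2 P (fun w => w : g_sigma_algebraType past_cylinders) (W l).
Proof.
move=> A C mA mC; rewrite preimage_id.
have mWC := measurable_preimage l mC.
have PC : P (W l @^-1` C) \is a fin_num by exact: fin_num_measure.
pose c : {nonneg R} := NngNum (fine_ge0 (measure_ge0 P (W l @^-1` C))).
have cE : c%:num%:E = P (W l @^-1` C) by rewrite /= fineK.
suff : mrestr P mWC A = mscale c P A.
  by rewrite /mrestr /mscale /= fineK // muleC.
apply: (@g_sigma_algebra_measure_unique _ _ _ past_cylinders
  measurable_past_cylinders (fun=> setT)) => //.
- by exists (fun=> setT) => //; apply/seteqP; split.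
- by rewrite bigcup_const.
- move=> _ _ [B mB ->] [D mD ->]; exists (fun i => B i `&` D i) => [i|].
    exact: measurableI.
  by rewrite -bigcapI.
- move=> _ [B mB ->]; rewrite /mrestr /= /mscale cE muleC.
  pose J := [set i : 'I_n | (i < l)%N]%SET.
  pose B' i := if i == l then C else B i.
  have mB' i : measurable (B' i) by rewrite /B'; case: eqP.
  have lJ : l \notin J by rewrite finset.inE ltnn.
  have B'J i : i \in J -> B' i = B i.
    by rewrite /B'; case: eqP => // ->; rewrite (negbTE lJ).
  have -> : \bigcap_(i in [set i : 'I_n | (i < l)%N]) (W i @^-1` B i) =
      \bigcap_(i in [set` J]) (W i @^-1` B' i).
    apply/seteqP; split => w h i /= il.
      by rewrite B'J //; apply: h; move: il; rewrite finset.inE.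
    by rewrite -(B'J i) ?finset.inE //; apply: h; rewrite /= finset.inE.
rewrite /mrestr.
  have -> : \bigcap_(i in [set` J]) (W i @^-1` B' i) `&` W l @^-1` C =
      \bigcap_(i in [set` (l |: J)%SET]) (W i @^-1` B' i).
    apply/seteqP; split => [w [h1 h2] i /=|w h].
      rewrite finset.inE => /orP[|iJ]; last exact: h1.
      by rewrite finset.inE => /eqP ->; rewrite /B' eqxx.
    split => [i iJ|]; first by apply: h; rewrite /= finset.inE iJ orbT.
    by have := h l; rewrite /= /B' eqxx finset.inE finset.inE eqxx; apply.
  rewrite !indW // finset.big_setU1 //= EFinM fineK; last first.
    by rewrite fin_num_measure //; exact: measurable_preimage.
  have -> : B' l = C by rewrite /B' eqxx.
  by rewrite muleC indW.
- by move=> k; rewrite /= /mrestr setTI ltey_eq fin_num_measure.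
Qed.

End Past.

Section FiniteSupport.
Local Open Scope ereal_scope.
Context {d : measure_display} {T : measurableType d} {R : realType}.
Context (Q : probability T R) (I : finType) (e : I -> T).
Context (inje : injective e) (me : forall i, measurable [set e i]).
Context (Qe : Q (range e) = 1).

Let rangeE : range e = \big[setU/set0]_(i <- index_enum I) [set e i].
Proof.
apply/seteqP; split => [_ [i _ <-]|x].
  by rewrite -bigcup_seq; exists i => //=; rewrite mem_index_enum.
by rewrite -bigcup_seq => -[i _ ->]; exists i.
Qed.

Lemma ge0_integral_finite_support (f : T -> \bar R) :
  measurable_fun [set: T] f -> (forall x, 0 <= f x) ->
  \int[Q]_x f x = \sum_i Q [set e i] * f (e i).
Proof.
move=> mf f0; have mr : measurable (range e).
  by rewrite rangeE; apply: bigsetU_measurable.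
have mN : measurable (~` range e) by exact: measurableC.
have QN : Q (~` range e) = 0 by rewrite probability_setC // Qe subee.
rewrite (ge0_negligible_integral mN measurableT mf _ QN) //.
rewrite setTD setCK rangeE ge0_integral_bigsetU //; last 3 first.
- exact: index_enum_uniq.
- by apply/trivIsetP => i j _ _ ij; apply/seteqP; split => // x [-> /inje]; apply/eqP.
- exact: measurable_funTS.
apply: eq_bigr => i _; rewrite (eq_integral (cst (f (e i)))).
  by rewrite integral_cst // muleC.
by move=> x; rewrite inE => ->.
Qed.

Lemma sum_finite_support : \sum_i Q [set e i] = 1.
Proof.
have : \int[Q]_x (cst 1) x = 1 by rewrite integral_cst // mul1e; exact: probability_setT.
rewrite ge0_integral_finite_support // => <-.
by apply: eq_bigr => i _; rewrite mule1.
Qed.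

Lemma integral_finite_support (f : T -> R) :
  measurable_fun [set: T] f ->
  \int[Q]_x (f x)%:E = (\sum_i fine (Q [set e i]) * f (e i))%:E.
Proof.
move=> mf; have mf' : measurable_fun [set: T] (EFin \o f) by exact/measurable_EFinP.
have Qfin i : Q [set e i] = (fine (Q [set e i]))%:E by rewrite fineK ?fin_num_measure.
rewrite integralE !ge0_integral_finite_support //; last 2 first.
- exact: measurable_funeneg.
- exact: measurable_funepos.
under eq_bigr do rewrite Qfin funeposE -EFin_max -EFinM.
under [X in _ - X]eq_bigr do rewrite Qfin funenegE -EFinN -EFin_max -EFinM.
rewrite !sumEFin -EFinB -sumrB; congr EFin; apply: eq_bigr => i _.
rewrite -mulrBr; congr (_ * _)%R; have [h|/ltW h] := leP 0%R (f (e i)).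
  by rewrite (_ : Num.max (- f (e i)) 0 = 0)%R ?subr0 // max_r // oppr_le0.
by rewrite (_ : Num.max (- f (e i)) 0 = - f (e i))%R ?sub0r ?opprK // max_l // oppr_ge0.
Qed.

End FiniteSupport.

(** * Concentration of the noise matrix *)

Section UnitDilation.
Context {R : realType} {m n : nat}.

Lemma delta_mx_tripotent (j : 'I_m) (k : 'I_n) :
  delta_mx j k *m (delta_mx j k)^T *m delta_mx j k = delta_mx j k :> 'M[R]_(m, n).
Proof. by rewrite trmx_delta !mul_delta_mx. Qed.

Lemma mxdot_delta p q (j : 'I_p) (k : 'I_q) (C : 'M[R]_(p, q)) : mxdot (delta_mx j k) C = C j k.
Proof.
rewrite mxdotE (bigD1 j) //= (bigD1 k) //= !big1 ?addr0; last 2 first.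
- by move=> i ij; rewrite big1 // => l _; rewrite mxE (negbTE ij) mul0r.
- by move=> l lk; rewrite mxE (negbTE lk) andbF mul0r.
by rewrite mxE !eqxx mul1r.
Qed.

Lemma unit_dilation_quadratic (j : 'I_m) (k : 'I_n) (G : 'M[R]_(m + n)) :
  mxdot (dilation (delta_mx j k)) (G *m dilation (delta_mx j k)) =
  ulsubmx G j j + drsubmx G k k.
Proof.
rewrite mxdotC mxdot_mulr dilation_sym dilation_sqr trmx_delta !mul_delta_mx.
rewrite -{1}(submxK G) /mxdot tr_block_mx mulmx_block mxtrace_block.
rewrite !mulmx0 addr0 add0r; congr (_ + _).
  by rewrite -[LHS]/(mxdot _ _) mxdotC mxdot_delta.
by rewrite -[LHS]/(mxdot _ _) mxdotC mxdot_delta.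
Qed.

(** The square of a dilated unit [(j, k)] projects onto the row index [j] and the column index [k].
    Summing counts each row index [n] times and each column index [m] times; this is how [M] enters
    the variance. *)
Lemma sum_unit_dilation_quadratic (M : nat) (A : 'M[R]_(m + n)) : A^T = A ->
  (m <= M)%N -> (n <= M)%N ->
  \sum_j \sum_k mxdot (dilation (delta_mx j k)) (mx_exp A *m dilation (delta_mx j k))
    <= M%:R * \tr (mx_exp A).
Proof.
move=> sA mM nM; have diag_ge0 i : 0 <= mx_exp A i i.
  have := mxdot_exp_ge0 (delta_mx i i) sA.
  by rewrite mxdotC mxdot_mulr trmx_delta mul_delta_mx mxdotC mxdot_delta.
have -> : \tr (mx_exp A) = \sum_j ulsubmx (mx_exp A) j j + \sum_k drsubmx (mx_exp A) k k.
  by rewrite -[in LHS](submxK (mx_exp A)) mxtrace_block.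
have ul0 : 0 <= \sum_j ulsubmx (mx_exp A) j j.
  by apply: sumr_ge0 => j _; rewrite ulsubmxEsub mxE diag_ge0.
have dr0 : 0 <= \sum_k drsubmx (mx_exp A) k k.
  by apply: sumr_ge0 => k _; rewrite drsubmxEsub mxE diag_ge0.
have -> : \sum_j \sum_k mxdot (dilation (delta_mx j k))
      (mx_exp A *m dilation (delta_mx j k)) =
    n%:R * (\sum_j ulsubmx (mx_exp A) j j) + m%:R * \sum_k drsubmx (mx_exp A) k k.
  under eq_bigr do under eq_bigr do rewrite unit_dilation_quadratic.
  under eq_bigr do rewrite big_split /= sumr_const card_ord -mulr_natl.
  by rewrite big_split /= -mulr_sumr sumr_const card_ord -[in LHS](mulr_natl (\sum_k _)).
by rewrite mulrDr lerD // ler_wpM2r // ler_nat.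
Qed.

End UnitDilation.

Section TailBound.
Context {R : realType}.

(** With [z = |x| / sigma], the square costs [(1 + z)^2 <= 16 e^(z/2)] and the exponent
    [2 + (1 + z)/4], because [theta * tau <= 1/16]. As [beta >= 1] gives [z <= 1 + z^beta], the
    total exponent stays below [4 + z^beta]. *)
Lemma exponential_remainder_le (beta sigma tau theta a x : R) :
  1 <= beta -> 0 < sigma -> sigma <= tau -> `|a| <= tau ->
  0 <= theta -> theta * tau <= 16^-1 ->
  2 * (theta * (a + x)) ^+ 2 * expR (2 + 4 * `|theta * (a + x)|) <=
  32 * expR 4 * (theta * tau) ^+ 2 * expR (`|x| `^ beta / sigma `^ beta).
Proof.
move=> beta1 sigma0 sigtau atau theta0 thtau.
have tau0 : 0 < tau by exact: lt_le_trans sigtau.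
have beta0 : 0 < beta by exact: lt_le_trans beta1.
pose z := `|x| / sigma.
have z0 : 0 <= z by rewrite divr_ge0 // ltW.
have zE : `|x| `^ beta / sigma `^ beta = z `^ beta.
  have -> : `|x| = z * sigma by rewrite /z divfK // gt_eqF.
  by rewrite (powRM _ z0 (ltW sigma0)) mulfK // gt_eqF // powR_gt0.
have zle : z <= 1 + z `^ beta.
  have [z1|/ltW z1] := leP z 1; first by rewrite (le_trans z1) // lerDl powR_ge0.
  rewrite -[leLHS](powRr1 z0) (le_trans (ler_powR z1 beta1)) // lerDr //.
have y1 : `|theta * (a + x)| <= theta * tau * (1 + z).
  rewrite normrM (ger0_norm theta0) -mulrA ler_wpM2l //.
  rewrite (le_trans (ler_normD _ _)) // mulrDr mulr1 lerD //.
  have -> : `|x| = sigma * z by rewrite /z mulrC divfK // gt_eqF.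
  by rewrite ler_wpM2r.
have tt0 : 0 <= theta * tau by rewrite mulr_ge0 // ltW.
have y2 : (theta * (a + x)) ^+ 2 <= (theta * tau) ^+ 2 * (1 + z) ^+ 2.
  rewrite -exprMn -real_normK ?num_real // lerXn2r ?nnegrE // mulr_ge0 //.
  by rewrite addr_ge0.
have z2 : (1 + z) ^+ 2 <= 16 * expR (z / 2).
  have h : 1 + z / 4 <= expR (z / 4) by exact: expR_ge1Dx.
  have -> : expR (z / 2) = expR (z / 4) ^+ 2.
    by rewrite -expRM_natr; congr expR; field.
  have -> : 16 * expR (z / 4) ^+ 2 = (4 * expR (z / 4)) ^+ 2 by ring.
  have h4 : 1 + z <= 4 * expR (z / 4).
    apply: (@le_trans _ _ (4 * (1 + z / 4))); last by rewrite ler_pM2l.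
    by clear -z0; lra.
  by apply: lerXn2r => //; [exact: addr_ge0 ler01 z0|exact: mulr_ge0 (ler0n _ _) (expR_ge0 _)].
have y4 : 4 * `|theta * (a + x)| <= (1 + z) / 4.
  have h : theta * tau * (1 + z) <= 16^-1 * (1 + z) by rewrite ler_wpM2r // (addr_ge0 ler01 z0).
  lra.
rewrite zE.
apply: (@le_trans _ _ (2 * ((theta * tau) ^+ 2 * (16 * expR (z / 2))) * expR (2 + (1 + z) / 4))).
  have Y0 : 0 <= 2 * (theta * (a + x)) ^+ 2 by apply: mulr_ge0 => //; exact: sqr_ge0.
  rewrite (ler_pM Y0 (expR_ge0 _)) // ?ler_expR ?lerD2l //.
  by rewrite ler_wpM2l // (le_trans y2) // ler_wpM2l // sqr_ge0.
have -> : 2 * ((theta * tau) ^+ 2 * (16 * expR (z / 2))) * expR (2 + (1 + z) / 4) =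
    32 * (theta * tau) ^+ 2 * expR (z / 2 + (2 + (1 + z) / 4)).
  by rewrite (expRD (z / 2)); ring.
have -> : 32 * expR 4 * (theta * tau) ^+ 2 * expR (z `^ beta) =
    32 * (theta * tau) ^+ 2 * expR (4 + z `^ beta).
  by rewrite (expRD 4); ring.
rewrite ler_wpM2l //; first by apply: mulr_ge0 => //; exact: sqr_ge0.
by rewrite ler_expR; lra.
Qed.

End TailBound.

Lemma matrix_unitsE (R : realType) m n :
  matrix_units R m n = range (fun jk : 'I_m * 'I_n => delta_mx jk.1 jk.2 : 'M[R]_(m, n)).
Proof.
apply/seteqP; split => [_ [j [k ->]]|_ [[j k] _ <-]].
  by exists (j, k) => //; rewrite trmx_delta mul_delta_mx.
by exists j, k; rewrite trmx_delta mul_delta_mx.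
Qed.

(** * Laws supported on matrix units *)

Section UnitDesign.
Context {R : realType} {m n : nat}.
Implicit Types (Q : probability 'M[R]_(m, n) R) (A B : 'M[R]_(m, n)).

Definition unit_weights Q : 'M[R]_(m, n) :=
  \matrix_(j, k) fine (Q [set delta_mx j k : 'M[R]_(m, n)]).

Lemma delta_mx_inj : injective (fun jk : 'I_m * 'I_n => delta_mx jk.1 jk.2 : 'M[R]_(m, n)).
Proof.
move=> [j k] [j' k'] /= /matrixP/(_ j k); rewrite !mxE !eqxx /=.
by case: eqP => [->|_]; case: eqP => [->|_] //= /eqP; rewrite oner_eq0.
Qed.

Lemma measurable_matrix_set1 A : measurable [set A].
Proof.
have -> : [set A] = \bigcap_(jk in [set: 'I_m * 'I_n])
    ((fun M : 'M[R]_(m, n) => M jk.1 jk.2) @^-1` [set A jk.1 jk.2]).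
  apply/seteqP; split => [_ -> [j k] //|M h].
  by apply/matrixP => j k; exact: (h (j, k) I).
apply: fin_bigcap_measurable => // -[j k] _; rewrite -[X in measurable X]setTI.
by apply: matrix_entry_measurable.
Qed.

Lemma measurable_fun_mxdot d (T : measurableType d) (f g : T -> 'M[R]_(m, n)) :
  (forall i j, measurable_fun [set: T] (fun t => f t i j)) ->
  (forall i j, measurable_fun [set: T] (fun t => g t i j)) ->
  measurable_fun [set: T] (fun t => mxdot (f t) (g t)).
Proof.
move=> mf mg; under eq_fun do rewrite mxdotE.
apply: measurable_sum => i; apply: measurable_sum => j.
exact: measurable_funM.
Qed.

Lemma unit_weights_ge0 Q j k : 0 <= unit_weights Q j k.
Proof. by rewrite mxE fine_ge0. Qed.

Lemma sum_unit_weights Q : Q (matrix_units R m n) = 1%E ->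
  \sum_j \sum_k unit_weights Q j k = 1.
Proof.
rewrite matrix_unitsE => Qu.
have /= := sum_finite_support delta_mx_inj (fun jk => measurable_matrix_set1 _) Qu.
rewrite (eq_bigr (fun jk => (fine (Q [set delta_mx jk.1 jk.2]))%:E)) => [|jk _]; last first.
  by rewrite fineK // fin_num_measure //; exact: measurable_matrix_set1.
rewrite sumEFin => -[<-]; rewrite pair_big /=.
by apply: eq_bigr => jk _; rewrite mxE.
Qed.

Lemma l2dot_unit_design Q A B : Q (matrix_units R m n) = 1%E ->
  l2dot Q A B = wdot (unit_weights Q) A B.
Proof.
rewrite matrix_unitsE /l2dot unlock => Qu.
rewrite (integral_finite_support delta_mx_inj (fun jk => measurable_matrix_set1 _) Qu).
  rewrite /wdot pair_big /=; apply: eq_bigr => jk _.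
  by rewrite mxE !(mxdotC _ (delta_mx _ _)) !mxdot_delta.
by apply: measurable_funM; apply: measurable_fun_mxdot => i j //; exact: matrix_entry_measurable.
Qed.

End UnitDesign.

Section NoiseStep.
Context {R : realType} {m n : nat} {d : measure_display} {T : measurableType d}.
Context (P : probability T R) (X : {RV P >-> 'M[R]_(m, n)}) (xi : {RV P >-> R}).
Context (Pi : probability 'M[R]_(m, n) R).
Context (beta sigma tau theta ct : R) (A0 : 'M[R]_(m, n)).
Context (beta1 : 1 <= beta) (sigma0 : 0 < sigma) (sigtau : sigma <= tau).
Context (theta0 : 0 <= theta) (thtau : theta * tau <= 16^-1).
Context (A0tau : forall j k, `|A0 j k| <= tau).
Context (lawX : has_law P X Pi) (Pi1 : Pi (matrix_units R m n) = 1%E).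
Context (indX : independent2 P X xi).
Context (ixi : P.-integrable [set: T] (EFin \o xi)).
Context (Exi : (\int[P]_w (xi w)%:E = 0)%E).
Context (tailxi : (\int[P]_w (expR (`|xi w| `^ beta / sigma `^ beta))%:E <= ct%:E)%E).

Let K := 32 * expR 4 * (theta * tau) ^+ 2.

Let tail w := expR (`|xi w| `^ beta / sigma `^ beta).

Let measurable_tail : measurable_fun [set: T] tail.
Proof.
have mxi : measurable_fun [set: T] xi by [].
apply: measurableT_comp => //; apply: measurable_funM => //.
exact: (measurableT_comp (measurable_powR beta)
  (measurableT_comp (@normr_measurable R setT) mxi)).
Qed.

Let integrable_tail : P.-integrable [set: T] (EFin \o tail).
Proof.
apply/integrableP; split; first by apply/measurable_EFinP; exact: measurable_tail.
under eq_integral do rewrite gee0_abs ?lee_fin ?expR_ge0 //.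
exact: le_lt_trans tailxi (ltry ct).
Qed.

(* The linear term in the noise integrates to zero. *)
Lemma trace_exp_noise_le (N : 'M[R]_(m, n)) (j : 'I_m) (k : 'I_n) (a : R) :
  `|a| <= tau ->
  (\int[P]_w (trace_exp (N + (theta * (a + xi w)) *: delta_mx j k))%:E <=
   (trace_exp N + theta * a * mxdot (dilation (delta_mx j k)) (mx_exp (dilation N)) +
    K * ct * mxdot (dilation (delta_mx j k))
      (mx_exp (dilation N) *m dilation (delta_mx j k)))%:E)%E.
Proof.
move=> atau; set D := dilation (delta_mx j k); set G := mx_exp (dilation N).
have D3 : D *m D *m D = D by apply: dilation_tripotent; exact: delta_mx_tripotent.
have q0 : 0 <= mxdot D (G *m D) by apply: mxdot_exp_ge0; exact: dilation_sym.
have K0 : 0 <= K by apply: mulr_ge0 (sqr_ge0 _); apply: mulr_ge0 => //; exact: expR_ge0.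
pose c1 := trace_exp N + theta * a * mxdot D G.
pose c2 := theta * mxdot D G; pose c3 := K * mxdot D (G *m D).
pose f w := (c1%:E + (c2%:E * (xi w)%:E + c3%:E * (tail w)%:E))%E.
have i1 : P.-integrable setT (fun=> c1%:E).
  exact: (finite_measure_integrable_cst P c1 measurableT).
have i2 : P.-integrable setT (fun w => c2%:E * (xi w)%:E)%E by exact: integrableZl.
have i3 : P.-integrable setT (fun w => c3%:E * (tail w)%:E)%E by exact: integrableZl integrable_tail.
have fle w : ((trace_exp (N + (theta * (a + xi w)) *: delta_mx j k))%:E <= f w)%E.
  rewrite /f -!EFinM -!EFinD lee_fin /trace_exp dilationD dilationZ.
  apply: le_trans (trace_exp_tripotent_le (dilation_sym _) D3 _ (dilation_sym _)) _.
  rewrite -/D -/G /c1 /c2 /c3 /trace_exp -/G mulrDr mulrDl.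
  have := ler_wpM2r q0 (exponential_remainder_le (xi w) beta1 sigma0 sigtau atau theta0 thtau).
  rewrite -/K -/(tail w) mulrDr; lra.
apply: (@le_trans _ _ (\int[P]_w f w)%E).
  apply: ge0_le_integral => //.
  - by move=> w _; rewrite lee_fin trace_exp_ge0.
  - apply/measurable_EFinP; apply: measurable_trace_exp => i l.
    under eq_fun do rewrite mxE [X in _ + X]mxE.
    apply: measurable_funD => //; apply: measurable_funM => //.
    by apply: measurable_funM => //; apply: measurable_funD.
  - by apply: emeasurable_funD => //; apply: emeasurable_funD; apply: measurable_int (i2) || apply: measurable_int (i3).
rewrite /f integralD //; last exact: integrableD.
have E1 : (\int[P]_w c1%:E = c1%:E)%E.
  transitivity (c1%:E * P setT)%E; first exact: integral_cst.
  by rewrite (probability_setT P) mule1.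
rewrite E1 integralD //.
rewrite [X in (_ + (X + _))%E]integralZl // Exi mule0 add0e integralZl //.
rewrite (_ : (_ + K * ct * _)%:E = c1%:E + c3%:E * ct%:E)%E; last first.
  by rewrite -EFinM -EFinD /c1 /c3; congr (_ + _)%:E; ring.
by rewrite leeD2l // lee_wpmul2l // lee_fin mulr_ge0.
Qed.

Let c0 : 'M[R]_(m, n) := \matrix_(j, k) (unit_weights Pi j k * A0 j k).

Let F (N : 'M[R]_(m, n)) (z : 'M[R]_(m, n) * R) : \bar R :=
  (trace_exp (N + (theta * (mxdot z.1 A0 + z.2)) *: z.1))%:E.

Let measurable_F N : measurable_fun [set: 'M[R]_(m, n) * R] (F N).
Proof.
have m1 i j : measurable_fun [set: 'M[R]_(m, n) * R] (fun z : 'M[R]_(m, n) * R => z.1 i j).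
  exact: (measurableT_comp (matrix_entry_measurable i j) measurable_fst).
apply/measurable_EFinP; apply: measurable_trace_exp => i j.
under eq_fun do rewrite mxE [X in _ + X]mxE.
apply: measurable_funD => //; apply: measurable_funM => //.
apply: measurable_funM => //; apply: measurable_funD => //.
by apply: measurable_fun_mxdot.
Qed.

(** The expansion is made at [N = S - theta c0]. Its averaged linear term, [theta] times the pairing
    of [dilation c0] with the exponential at [N], is the increment of the tangent from [N] to [S],
    so both disappear into [trace_exp S]. *)
Lemma trace_exp_unit_step (M : nat) (pmax : R) (S : 'M[R]_(m, n)) :
  (m <= M)%N -> (n <= M)%N -> 0 <= ct -> 0 <= pmax ->
  (forall j k, unit_weights Pi j k <= pmax) ->
  theta * frobenius_norm (dilation c0) <= 2^-1 ->
  (\int[P]_w (trace_exp (S - theta *: c0 +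
      (theta * (mxdot (X w) A0 + xi w)) *: X w))%:E <=
   ((1 + 2 * (K * ct) * (pmax * M%:R)) * trace_exp S)%:E)%E.
Proof.
move=> mM nM ct0 pmax0 wmax c0le; set N := S - theta *: c0.
have Kct0 : 0 <= K * ct.
  by apply: mulr_ge0 => //; apply: mulr_ge0 (sqr_ge0 _); apply: mulr_ge0 => //; exact: expR_ge0.
rewrite [leLHS](independent2_tonelli (F := F N) _ _ indX) //; last first.
  by move=> z; rewrite lee_fin trace_exp_ge0.
pose V x : \bar R := (\int[distribution P xi]_y F N (x, y))%E.
have mV : measurable_fun setT V.
  by apply: measurable_fun_fubini_tonelli_F => // z; rewrite lee_fin trace_exp_ge0.
have VE x : V x = (\int[P]_w F N (x, xi w))%E.
  rewrite /V ge0_integral_distribution //.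
    exact: (measurableT_comp (measurable_F N) (pair1_measurable x)).
  by move=> y; rewrite lee_fin trace_exp_ge0.
have V0 x : (0 <= V x)%E by apply: integral_ge0 => y _; rewrite lee_fin trace_exp_ge0.
under eq_integral do rewrite -VE.
rewrite -[leLHS](ge0_integral_distribution X mV V0).
rewrite (eq_measure_integral Pi) => [|B mB _]; last exact: lawX.
have Piu := Pi1; rewrite matrix_unitsE in Piu.
rewrite (ge0_integral_finite_support delta_mx_inj (fun jk => measurable_matrix_set1 _) Piu) //.
set G := mx_exp (dilation N).
pose g j k : R := mxdot (dilation (delta_mx j k)) G.
pose q j k : R := mxdot (dilation (delta_mx j k)) (G *m dilation (delta_mx j k)).
pose v j k : R := trace_exp N + theta * A0 j k * g j k + K * ct * q j k.
have q0 j k : 0 <= q j k by apply: mxdot_exp_ge0; exact: dilation_sym.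
have Vle j k : (V (delta_mx j k) <= (v j k)%:E)%E.
  have atau : `|mxdot (delta_mx j k) A0| <= tau by rewrite mxdot_delta.
  by have := trace_exp_noise_le N j k atau; rewrite VE /v -(mxdot_delta j k A0).
apply: (@le_trans _ _ (\sum_j \sum_k unit_weights Pi j k * v j k)%:E).
  rewrite pair_big -sumEFin; apply: lee_sum => -[j k] _ /=.
  rewrite mxE EFinM fineK; last by rewrite fin_num_measure //; exact: measurable_matrix_set1.
  by rewrite lee_wpmul2l.
rewrite lee_fin.
have -> : \sum_j \sum_k unit_weights Pi j k * v j k =
    trace_exp N + theta * mxdot (dilation c0) G +
    K * ct * \sum_j \sum_k unit_weights Pi j k * q j k.
  have -> : mxdot (dilation c0) G = \sum_j \sum_k unit_weights Pi j k * A0 j k * g j k.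
    rewrite mxdot_dilation mxdotE; apply: eq_bigr => j _; apply: eq_bigr => k _.
    by rewrite /g mxdot_dilation mxdot_delta [c0 _ _]mxE.
  rewrite -[X in X + _ + _]mul1r -(sum_unit_weights Pi1) mulr_suml !mulr_sumr -!big_split /=.
  apply: eq_bigr => j _; rewrite mulr_suml !mulr_sumr -!big_split /=.
  by apply: eq_bigr => k _; rewrite /v; ring.
have trG : \tr G = trace_exp N by [].
have sq : \sum_j \sum_k unit_weights Pi j k * q j k <= pmax * (M%:R * trace_exp N).
  rewrite -trG; apply: (@le_trans _ _ (pmax * \sum_j \sum_k q j k)).
    rewrite mulr_sumr; apply: ler_sum => j _; rewrite mulr_sumr.
    by apply: ler_sum => k _; rewrite ler_wpM2r.
  rewrite ler_wpM2l //.
  exact: sum_unit_dilation_quadratic (dilation_sym N) mM nM.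
have h1 : trace_exp N + theta * mxdot (dilation c0) G <= trace_exp S.
  have SN : S - N = theta *: c0 by rewrite /N opprB addrC subrK.
  by have := trace_exp_tangent_dilation S N; rewrite -/G SN dilationZ mxdotZl.
(* The variance term is still taken at [N]; smallness of [theta c0] moves it to [S] at the price of
   a factor 2. *)
have h2 : - (theta * mxdot (dilation c0) G) <= 2^-1 * trace_exp N.
  have := mxdot_exp_frobenius (dilation c0) (dilation_sym N); rewrite -/G trG => h.
  have := ler_wpM2l theta0 h; rewrite mulrA => {}h.
  apply: le_trans (le_trans _ h) _; last by rewrite ler_wpM2r // trace_exp_ge0.
  by rewrite -mulrN ler_wpM2l // -normrN ler_norm.
have NS : trace_exp N <= 2 * trace_exp S by lra.
have := ler_wpM2l Kct0 sq; have := ler_wpM2l (mulr_ge0 pmax0 (ler0n R M)) NS.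
move=> /(ler_wpM2l Kct0); rewrite [pmax * (_ * _)]mulrA => h3 h4.
apply: le_trans (lerD h1 (le_trans h4 h3)) _.
by rewrite le_eqVlt; apply/orP; left; apply/eqP; ring.
Qed.

End NoiseStep.

Section TraceExpConcentration.
Context {R : realType} {m n N : nat} {d : measure_display} {T : measurableType d}.
Context (P : probability T R) (X : 'I_N -> T -> 'M[R]_(m, n)) (Y : 'I_N -> T -> R).
Context (mX : forall i, measurable_fun [set: T] (X i)).
Context (mY : forall i, measurable_fun [set: T] (Y i)).
Context (indXY : mutually_independent P
  (fun i w => (X i w, Y i w) : ('M[R]_(m, n) * R)%type)).
Context (theta kappa : R) (c0 : 'M[R]_(m, n)) (kappa0 : 0 <= kappa).
Context (step : forall i (S : 'M[R]_(m, n)),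
  (\int[P]_w (trace_exp (S - theta *: c0 + (theta * Y i w) *: X i w))%:E <=
   ((1 + kappa) * trace_exp S)%:E)%E).

Let W i w : ('M[R]_(m, n) * R)%type := (X i w, Y i w).

Let mW i : measurable_fun [set: T] (W i).
Proof. exact: measurable_fun_pair. Qed.

Let partial (l : nat) w : 'M[R]_(m, n) :=
  \sum_(i < N | (i < l)%N) (Y i w *: X i w - c0).

(** Stated through a map [f] into [T] to cover both [T] itself and the space carrying the past
    sigma-algebra, where only observations before [l] are known to be measurable. *)
Let measurable_partial l d' (T' : measurableType d') (f : T' -> T) :
  (forall i : 'I_N, (i < l)%N -> measurable_fun [set: T'] (W i \o f)) ->
  forall j k, measurable_fun [set: T'] (fun t => partial l (f t) j k).
Proof.
move=> mf j k; rewrite /partial; under eq_fun do rewrite summxE.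
under eq_fun do rewrite big_mkcond.
apply: measurable_sum => i; have [il|_] := boolP (i < l)%N; last exact: measurable_cst.
under eq_fun do rewrite mxE [X in X + _]mxE [X in _ + X]mxE.
have m2 : measurable_fun [set: T'] (fun t => Y i (f t)).
  exact: (measurableT_comp measurable_snd (mf i il)).
have m1 : measurable_fun [set: T'] (fun t => X i (f t) j k).
  exact: (measurableT_comp (matrix_entry_measurable j k)
    (measurableT_comp measurable_fst (mf i il))).
by apply: measurable_funD => //; apply: measurable_funM.
Qed.

Let measurable_trace_exp_partial l :
  measurable_fun [set: T] (fun w => trace_exp (theta *: partial l w)).
Proof.
apply: measurable_trace_exp => j k; under eq_fun do rewrite mxE.
by apply: measurable_funM => //; apply: (measurable_partial (f := id)) => i _; exact: mW.
Qed.

(** Induction on the number of observations: independence freezes the partial sum, [step] averages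
    over the next observation. The start is the trace of the identity of size [m + n]. *)
Lemma trace_exp_partial_le (l : nat) : (l <= N)%N ->
  (\int[P]_w (trace_exp (theta *: partial l w))%:E <=
   ((1 + kappa) ^+ l * (m + n)%:R)%:E)%E.
Proof.
elim: l => [_|l IHl lN].
  rewrite expr0 mul1r; under eq_integral do
    rewrite /partial big_pred0 // scaler0 trace_exp0.
  rewrite (_ : (\int[P]_w _ = (m + n)%:R%:E * P setT)%E); last exact: integral_cst.
  by rewrite (probability_setT P) mule1.
pose i := Ordinal lN.
pose G := g_sigma_algebraType (past_cylinders W i).
pose F (z : G * ('M[R]_(m, n) * R)) : \bar R :=
  (trace_exp (theta *: partial l z.1 - theta *: c0 + (theta * z.2.2) *: z.2.1))%:E.
have F0 z : (0 <= F z)%E by rewrite lee_fin trace_exp_ge0.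
have mF : measurable_fun setT F.
  apply/measurable_EFinP; apply: measurable_trace_exp => j k.
  under eq_fun do rewrite mxE [X in X + _]mxE [X in _ + X]mxE.
  apply: measurable_funD.
    apply: measurable_funD => //; under eq_fun do rewrite mxE.
    apply: measurable_funM => //; apply: measurable_partial => i' il.
    exact: (measurableT_comp (measurable_past (W := W) (l := i) il) measurable_fst).
  apply: measurable_funM.
    apply: measurable_funM => //.
    exact: (measurableT_comp measurable_snd measurable_snd).
  exact: (measurableT_comp (matrix_entry_measurable j k)
    (measurableT_comp measurable_fst measurable_snd)).
have FE w : (trace_exp (theta *: partial l.+1 w))%:E = F (w, W i w).
  rewrite /F /=; congr (trace_exp _)%:E.
  have -> : partial l.+1 w = partial l w + (Y i w *: X i w - c0).
    rewrite /partial [LHS](bigD1 i) //= addrC; congr (_ + _).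
    apply: eq_bigl => i'; rewrite -(inj_eq val_inj) /= ltnS.
    by rewrite andbC -ltn_neqAle.
  by rewrite scalerDr scalerBr scalerA addrA addrAC.
under eq_integral do rewrite FE.
rewrite (independent2_tonelli (measurable_fun_past (l := i) mW) (mW i) (independent2_past (l := i) mW indXY) mF F0).
pose W' : {mfun T >-> ('M[R]_(m, n) * R)%type} :=
  HB.pack (W i) (isMeasurableFun.Build _ _ _ _ _ (mW i)).
pose V (x : G) : \bar R := (\int[distribution P W']_y F (x, y))%E.
have VE x : V x = (\int[P]_w F (x, W i w))%E.
  rewrite /V ge0_integral_distribution //.
  exact: (measurableT_comp mF (pair1_measurable x)).
have mV : measurable_fun setT V by exact: measurable_fun_fubini_tonelli_F.
under eq_integral do rewrite -VE.
apply: (@le_trans _ _ (\int[P]_w ((1 + kappa)%:E * (trace_exp (theta *: partial l w))%:E))%E).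
  apply: ge0_le_integral => //.
  - by move=> w _; apply: integral_ge0.
  - exact: (measurableT_comp mV (measurable_fun_past (l := i) mW)).
  - apply: measurable_funeM; apply/measurable_EFinP.
    exact: measurable_trace_exp_partial.
  - by move=> w _; rewrite (VE w) -EFinM; exact: (step i (theta *: partial l w)).
rewrite ge0_integralZl_EFin //; last 3 first.
- by move=> w _; rewrite lee_fin trace_exp_ge0.
- by apply/measurable_EFinP; exact: measurable_trace_exp_partial.
- by rewrite addr_ge0.
rewrite exprS -mulrA EFinM lee_wpmul2l ?lee_fin ?addr_ge0 //.
exact/IHl/ltnW.
Qed.

(** Markov's inequality for the trace. The event is a sublevel set of [trace_exp], so it is
    measurable and serves all [u] and [v] at once. *)
Lemma bilinear_concentration (L : R) :
  exists E : set T, [/\ measurable E,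
    ((1 - expR (- L) * ((1 + kappa) ^+ N * (m + n)%:R))%:E <= P E)%E &
    forall w, E w -> forall (u : 'cV[R]_m) (v : 'cV[R]_n),
      mxdot u u = 1 -> mxdot v v = 1 ->
      theta * mxdot (\sum_i (Y i w *: X i w - c0)) (u *m v^T) <= L].
Proof.
have fullE w : partial N w = \sum_i (Y i w *: X i w - c0).
  by apply: eq_bigl => i; rewrite ltn_ord.
pose B := [set w | expR L < trace_exp (theta *: partial N w)].
have mB : measurable B.
  have := measurable_trace_exp_partial N measurableT (measurable_itv `]expR L, +oo[).
  by rewrite setTI set_itvE.
exists (~` B); split; first exact: measurableC.
  rewrite probability_setC // EFinB leeB //.
  have PBfin : P B \is a fin_num by rewrite fin_num_measure.
  have : ((expR L)%:E * P B <= ((1 + kappa) ^+ N * (m + n)%:R)%:E)%E.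
    apply: le_trans (trace_exp_partial_le (leqnn N)).
    rewrite -(integral_cst P mB) (@le_trans _ _ (\int[P]_(w in B) (trace_exp (theta *: partial N w))%:E)%E) //.
      apply: ge0_le_integral => //.
      - by move=> w _; rewrite lee_fin expR_ge0.
      - by apply: measurable_funTS; apply/measurable_EFinP; exact: measurable_trace_exp_partial.
      - by move=> w /= Bw; rewrite lee_fin ltW.
    apply: ge0_subset_integral => //.
    - by apply/measurable_EFinP; exact: measurable_trace_exp_partial.
    - by move=> w _; rewrite lee_fin trace_exp_ge0.
  rewrite -(fineK PBfin) -EFinM !lee_fin => h.
  by rewrite expRN ler_pdivlMl ?expR_gt0.
move=> w /negP; rewrite /= -leNgt => Bw u v u1 v1.
rewrite -mxdotZl -fullE; exact: bilinear_le_of_trace_exp.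
Qed.

End TraceExpConcentration.

Section ArgminEvent.
Context {R : realType} {m n : nat}.
Implicit Types (A B N : 'M[R]_(m, n)).

Lemma frobenius_rank1 (u : 'cV[R]_m) (v : 'cV[R]_n) :
  mxdot u u = 1 -> mxdot v v = 1 -> frobenius_norm (u *m v^T) = 1.
Proof.
by move=> u1 v1; rewrite /frobenius_norm mxdot_rank1 u1 v1 mulr1 sqrtr1.
Qed.

Lemma spectral_norm_bilinear A (u : 'cV[R]_m) (v : 'cV[R]_n) :
  mxdot u u = 1 -> mxdot v v = 1 -> mxdot A (u *m v^T) <= spectral_norm A.
Proof.
move=> u1 v1; have -> : mxdot A (u *m v^T) = mxdot u (A *m v).
  by rewrite mxdotC mxdot_mulr trmxK.
rewrite (le_trans (mxdot_le_frobenius _ _)) // /frobenius_norm u1 sqrtr1 mul1r.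
rewrite -[leRHS](ger0_norm (spectral_norm_ge0 A)) -sqrtr_sqr ler_sqrt ?sqr_ge0 //.
by have := mulmx_spectral_norm A v; rewrite v1 mulr1.
Qed.

Lemma spectral_norm_le_unit A (c : R) : 0 <= c ->
  (forall (u : 'cV[R]_m) (v : 'cV[R]_n), mxdot u u = 1 -> mxdot v v = 1 ->
     mxdot A (u *m v^T) <= c) -> spectral_norm A <= c.
Proof. by move=> c0 Ac; apply: spectral_norm_le => //; exact: spectral_norm_le_bilinear. Qed.

Lemma spectral_norm_frobenius A B :
  spectral_norm A <= spectral_norm B + frobenius_norm (A - B).
Proof.
apply: spectral_norm_le_unit => [|u v u1 v1].
  by rewrite addr_ge0 ?spectral_norm_ge0 ?frobenius_ge0.
rewrite -[in leLHS](subrK B A) mxdotDl addrC lerD ?spectral_norm_bilinear //.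
by rewrite (le_trans (mxdot_le_frobenius _ _)) // frobenius_rank1 ?mulr1.
Qed.

Lemma frobenius_ball_open N (r : R) : open [set M | frobenius_norm (M - N) < r].
Proof.
have [r0|r0] := leP r 0.
  rewrite (_ : [set M | _] = set0); first exact: open0.
  by apply/seteqP; split => // M /= /lt_le_trans/(_ r0); rewrite ltNge frobenius_ge0.
pose f (M : 'M[R]_(m, n)) : R := \sum_i \sum_j (M i j - N i j) * (M i j - N i j).
have fE M : (frobenius_norm (M - N) < r) = (f M < r ^+ 2).
  rewrite -(@ltr_pXn2r _ 2) ?nnegrE ?frobenius_ge0 ?(ltW r0) // sqr_frobenius mxdotE /f.
  by congr (_ < _); do 2!apply: eq_bigr => ? _; rewrite !mxE.
have -> : [set M | frobenius_norm (M - N) < r] = f @^-1` [set x | x < r ^+ 2].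
  by apply/seteqP; split => M /=; rewrite fE.
apply: (open_comp (f := f)) => [M _|]; last exact: open_lt.
apply: (continuous_big add_continuous) => i _.
apply: (continuous_big add_continuous) => j _ M'.
have h : {for M', continuous (fun M : 'M[R]_(m, n) => M i j - N i j)}.
  apply: (@continuousB _ _ _ (fun M : 'M[R]_(m, n) => M i j) (cst (N i j)) M').
    exact: (@coord_continuous R m n i j M').
  exact: cst_continuous.
exact: (@continuousM _ _ (fun M : 'M[R]_(m, n) => M i j - N i j) _ M' h h).
Qed.

(* The bad event is the preimage under the data matrix [N] of an open set,
   because the minimizer depends on [N] in a Lipschitz way. *)
Lemma measurable_argmin_event d (T : measurableType d) (w : 'M[R]_(m, n)) (k lam c : R)
    A0 (N Ahat : T -> 'M[R]_(m, n)) :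
  0 < k -> 0 < lam -> (forall i j, k <= w i j) ->
  (forall i j, measurable_fun [set: T] (fun t => N t i j)) ->
  (forall t, is_argmin (penalized w lam A0 (N t)) (Ahat t)) ->
  measurable [set t | spectral_norm (Ahat t - A0) <= c].
Proof.
move=> k0 lam0 kw mN amin; rewrite -[X in measurable X]setCK; apply: measurableC.
(* The excess over [c] divided by the Lipschitz constant [2 / k]: data within this distance of [N t]
   still give a spectral norm above [c]. *)
pose rho t := k / 2 * (spectral_norm (Ahat t - A0) - c).
pose U := \bigcup_(t in [set t | c < spectral_norm (Ahat t - A0)])
  [set M | frobenius_norm (M - N t) < rho t].
have -> : ~` [set t | spectral_norm (Ahat t - A0) <= c] = N @^-1` U.
  apply/seteqP; split => t /=.
    move=> /negP; rewrite -ltNge => ct; exists t => //=.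
    by rewrite subrr /frobenius_norm mxdot0l sqrtr0 /rho mulr_gt0 ?divr_gt0 ?subr_gt0.
  move=> [t0 /= ct0 Nt]; apply/negP; rewrite -ltNge.
  have h1 := penalized_argmin_lipschitz k0 lam0 kw (amin t) (amin t0).
  have h2 := spectral_norm_frobenius (Ahat t0 - A0) (Ahat t - A0).
  have E : Ahat t0 - A0 - (Ahat t - A0) = - (Ahat t - Ahat t0).
    by apply/matrixP => i j; rewrite !mxE; ring.
  have h3 : 2 / k * frobenius_norm (N t - N t0) < spectral_norm (Ahat t0 - A0) - c.
    have -> : spectral_norm (Ahat t0 - A0) - c = 2 / k * rho t0.
      by rewrite /rho; field; rewrite gt_eqF.
    by rewrite ltr_pM2l // divr_gt0.
  move: h2; rewrite E /frobenius_norm mxdotNl mxdotNr opprK -/(frobenius_norm _) => h2.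
  have := le_lt_trans h1 h3; lra.
apply: measurable_preimage_open => //; apply: bigcup_open => t _.
exact: frobenius_ball_open.
Qed.

End ArgminEvent.

(** * The estimator *)

Section DesignConstants.
Context {R : realType} {m n : nat} (Pi : probability 'M[R]_(m, n) R).
Context (Pi1 : Pi (matrix_units R m n) = 1%E).
Implicit Types A B : 'M[R]_(m, n).

Let q := unit_weights Pi.

Let q_le1 j k : q j k <= 1.
Proof.
rewrite -(sum_unit_weights Pi1) (bigD1 j) //= (bigD1 k) //= -addrA lerDl.
rewrite addr_ge0 //; first by apply: sumr_ge0 => *; exact: unit_weights_ge0.
by do 2!apply: sumr_ge0 => ? _; exact: unit_weights_ge0.
Qed.

Let delta_unit_rank1 (j : 'I_m) (k : 'I_n) : unit_rank1 (delta_mx j k : 'M[R]_(m, n)).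
Proof.
split; last by rewrite mxrank_delta.
by rewrite /frobenius_norm mxdot_delta mxE !eqxx sqrtr1.
Qed.

Let l2norm_delta (j : 'I_m) (k : 'I_n) : l2norm Pi (delta_mx j k) = Num.sqrt (q j k).
Proof.
by rewrite /l2norm l2dot_unit_design // wdotE mxdotC mxdot_delta !mxE !eqxx mulr1.
Qed.

(** Bounds from above the sets whose suprema define [kappa1'] and [coherence], which is required
    before [sup] can be used as an upper bound. *)
Lemma wdot_le_frobenius A B : `|wdot q A B| <= frobenius_norm A * frobenius_norm B.
Proof.
have le C : wdot q C B <= frobenius_norm C * frobenius_norm B.
  rewrite wdotE (le_trans (mxdot_le_frobenius _ _)) // ler_wpM2r ?frobenius_ge0 //.
  rewrite ler_sqrt ?mxdot_ge0 // !mxdotE; do 2!apply: ler_sum => ? _.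
  rewrite mxE mulrACA -[leRHS]mul1r ler_wpM2r // -expr2 ?sqr_ge0 //.
  by rewrite expr_le1 ?q_le1 ?unit_weights_ge0.
have [_|_] := ger0P (wdot q A B); first exact: le.
by rewrite -wdotNl (le_trans (le _)) // /frobenius_norm mxdotNl mxdotNr opprK.
Qed.

(** Matrix units compete in the infimum, and the squared [l2norm] of a unit is its probability. *)
Lemma kappa1_le_weights j k : 0 <= kappa1 Pi -> kappa1 Pi ^+ 2 <= q j k.
Proof.
move=> k0; rewrite -(sqr_sqrtr (unit_weights_ge0 Pi j k)) -/q.
rewrite lerXn2r ?nnegrE ?sqrtr_ge0 // -l2norm_delta; apply: ge_inf.
  by exists 0 => _ [B _ <-]; exact: sqrtr_ge0.
by exists (delta_mx j k) => //; exact: delta_unit_rank1.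
Qed.

Lemma weights_le_kappa1' j k (c : R) : 0 <= c -> kappa1' Pi <= Num.sqrt c -> q j k <= c.
Proof.
move=> c0 kc; rewrite -ler_sqrt // -l2norm_delta (le_trans _ kc) //.
apply: ub_le_sup; last by exists (delta_mx j k) => //; exact: delta_unit_rank1.
exists 1 => _ [B [B1 _] <-]; rewrite /l2norm -[leRHS]sqrtr1 ler_sqrt //.
rewrite l2dot_unit_design // (le_trans (ler_norm _)) // (le_trans (wdot_le_frobenius _ _)) //.
by rewrite B1 mulr1.
Qed.

Lemma wdot_le_coherence A B : mxdot A B = 0 ->
  `|wdot q A B| <= coherence Pi * (nuclear_norm A * nuclear_norm B).
Proof.
move=> AB.
have wdot0l C : wdot q 0 C = 0 by rewrite -(scale0r 0) wdotZl mul0r.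
have n0 : nuclear_norm (0 : 'M[R]_(m, n)) = 0.
  by rewrite -(scale0r 0) nuclear_normZ // mul0r.
have [->|A0] := eqVneq A 0; first by rewrite wdot0l normr0 n0 mul0r mulr0.
have [->|B0] := eqVneq B 0; first by rewrite wdotC wdot0l normr0 n0 !mulr0.
have np C : C != 0 -> 0 < nuclear_norm C.
  by move=> C0; rewrite (lt_le_trans _ (frobenius_le_nuclear C)) // sqrtr_gt0 mxdot_gt0.
rewrite -ler_pdivrMr ?mulr_gt0 ?np //; apply: ub_le_sup; last first.
  by exists A, B; split => //; rewrite l2dot_unit_design.
exists 1 => _ [C [D [C0 D0 _ ->]]].
rewrite ler_pdivrMr ?mulr_gt0 ?np // mul1r l2dot_unit_design //.
by rewrite (le_trans (wdot_le_frobenius _ _)) // ler_pM ?frobenius_ge0 ?frobenius_le_nuclear.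
Qed.

Lemma frobenius_weighted_le A (tau : R) : 0 <= tau -> (forall j k, `|A j k| <= tau) ->
  frobenius_norm (\matrix_(j, k) (q j k * A j k)) <= tau.
Proof.
move=> tau0 Atau; rewrite -(@ler_pXn2r _ 2) ?nnegrE ?frobenius_ge0 // sqr_frobenius mxdotE.
rewrite -[leRHS]mul1r -(sum_unit_weights Pi1) mulr_suml; apply: ler_sum => j _.
rewrite mulr_suml; apply: ler_sum => k _; rewrite mxE -/q mulrACA -!expr2.
rewrite ler_pM ?sqr_ge0 //; first by rewrite expr2 ler_piMr ?q_le1 ?unit_weights_ge0.
by rewrite -(real_normK (num_real (A j k))); apply: lerXn2r; rewrite ?nnegrE.
Qed.

End DesignConstants.

Lemma half_le_ln (R : realType) (m : nat) : (2 <= m)%N -> 2^-1 <= ln m%:R :> R.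
Proof.
move=> m2; apply: (@le_trans _ _ (ln 2)); last by rewrite ler_ln ?posrE ?ltr0n ?ler_nat // (leq_trans _ m2).
rewrite -[leLHS]expRK ler_ln ?posrE ?expR_gt0 //.
have h := expR_ge1Dx (- 2^-1 : R).
have e0 := expR_gt0 (2^-1 : R).
have : expR (2^-1) * expR (- 2^-1) = 1 :> R by rewrite expRxMexpNx_1.
have := ler_wpM2l (ltW e0) h; lra.
Qed.

Lemma powR_ge_quarter (R : realType) (x s : R) : 2^-1 <= x -> 0 <= s -> s <= 2 ->
  4^-1 <= x `^ s.
Proof.
move=> x2 s0 s2; have x0 : 0 <= x by rewrite (le_trans _ x2).
have h1 : 1 <= (2 * x) `^ s.
  by rewrite -[leLHS](powRr0 (2 * x)) ler_powR //; lra.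
have h2 : 2 `^ s <= 4 :> R.
  apply: (le_trans (ler_powR _ s2)); first by rewrite ler1n.
  by rewrite powR_mulrn // expr2; lra.
rewrite powRM // in h1; have := ler_wpM2r (powR_ge0 x s) h2; lra.
Qed.

(** The logarithm may be below 1 for the smallest dimension, so its extra power is bounded below by
    [(1/2)^2], using [2 / beta <= 2]; hence the 4. *)
Lemma sampling_ratio_le (R : realType) (beta L M q N : R) :
  1 <= beta -> 2^-1 <= L -> 0 <= q -> q <= M -> 0 < N ->
  M * L `^ (1 + 2 / beta) < N -> q * L / N <= 4.
Proof.
move=> beta1 L2 q0 qM N0 MLN.
have beta0 : 0 < beta by rewrite (lt_le_trans _ beta1).
have L0 : 0 < L by rewrite (lt_le_trans _ L2).
have h : 4^-1 <= L `^ (2 / beta).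
  apply: powR_ge_quarter => //; first by rewrite divr_ge0 // ltW.
  by rewrite ler_pdivrMr // ler_peMr.
rewrite ler_pdivrMr //.
rewrite powRD ?(gt_eqF L0) ?implybT // powRr1 ?ltW // in MLN.
have qL : 0 <= q * L by rewrite mulr_ge0 // ltW.
have h1 := ler_wpM2l qL h.
have h2 : q * L * L `^ (2 / beta) <= M * (L * L `^ (2 / beta)).
  by rewrite -mulrA ler_wpM2r // mulr_ge0 ?powR_ge0 // ltW.
have h3 := le_lt_trans (le_trans h1 h2) MLN.
lra.
Qed.

(** * Calibration of the Laplace parameter *)

Section NoiseEvent.
Context {R : realType} {m n N : nat} {d : measure_display} {T : measurableType d}.
Context (P : probability T R) (X : 'I_N -> {RV P >-> 'M[R]_(m, n)}).
Context (xi : 'I_N -> {RV P >-> R}) (Pi : probability 'M[R]_(m, n) R).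
Context (beta sigma tau ct cmax : R) (A0 : 'M[R]_(m, n)).
Context (m0 : (0 < m)%N) (n0 : (0 < n)%N).
Context (beta1 : 1 <= beta) (sigma0 : 0 < sigma) (sigtau : sigma <= tau).
Context (ct0 : 0 <= ct) (cmax0 : 0 <= cmax).
Context (A0tau : forall j k, `|A0 j k| <= tau).
Context (lawX : forall i, has_law P (X i) Pi) (Pi1 : Pi (matrix_units R m n) = 1%E).
Context (indX : forall i, independent2 P (X i) (xi i)).
Context (ixi : forall i, P.-integrable [set: T] (EFin \o xi i)).
Context (Exi : forall i, (\int[P]_w (xi i w)%:E = 0)%E).
Context (tailxi : forall i,
  (\int[P]_w (expR (`|xi i w| `^ beta / sigma `^ beta))%:E <= ct%:E)%E).
Context (wmax : forall j k, unit_weights Pi j k <= cmax / (m%:R * n%:R)).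

Let Y i w := mxdot (X i w) A0 + xi i w.

Context (indXY : mutually_independent P
  (fun i w => (X i w, Y i w) : ('M[R]_(m, n) * R)%type)).
Context (size : (maxn m n)%:R * ln (m + n)%:R `^ (1 + 2 / beta) < N%:R :> R).

Let c0 : 'M[R]_(m, n) := \matrix_(j, k) (unit_weights Pi j k * A0 j k).

Lemma noise_event : exists E : set T, [/\ measurable E,
  ((1 - (m + n)%:R^-1)%:E <= P E)%E &
  forall w, E w -> forall (u : 'cV[R]_m) (v : 'cV[R]_n),
    mxdot u u = 1 -> mxdot v v = 1 ->
    mxdot (N%:R^-1 *: \sum_i Y i w *: X i w - c0) (u *m v^T) <=
    32 * (expR 4 * ct * cmax / 16 + 2) * tau *
      Num.sqrt (ln (m + n)%:R / ((minn m n)%:R * N%:R))].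
Proof.
pose L : R := ln (m + n)%:R; pose q : R := (minn m n)%:R; pose M : R := (maxn m n)%:R.
have mn2 : (2 <= m + n)%N by rewrite -[2%N]/(1 + 1)%N leq_add.
have mn0 : 0 < (m + n)%:R :> R by rewrite ltr0n (leq_trans _ mn2).
have L2 : 2^-1 <= L by exact: half_le_ln.
have L0 : 0 < L by rewrite (lt_le_trans _ L2).
have q0 : 0 < q by rewrite ltr0n leq_min m0.
have qM : q <= M by rewrite ler_nat geq_min leq_maxl.
have N0 : 0 < N%:R :> R.
  by apply: le_lt_trans size; rewrite mulr_ge0 // powR_ge0.
have tau0 : 0 < tau by rewrite (lt_le_trans sigma0).
pose s := Num.sqrt (q * L / N%:R).
have s0 : 0 < s by rewrite sqrtr_gt0 divr_gt0 // mulr_gt0.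
have qLN0 : 0 <= q * L / N%:R by rewrite divr_ge0 ?mulr_ge0 // ltW.
have sqrE : s ^+ 2 = q * L / N%:R by rewrite sqr_sqrtr.
have s2 : s <= 2.
  rewrite -(@ler_pXn2r _ 2) ?nnegrE ?(ltW s0) // sqrE.
  rewrite (le_trans (sampling_ratio_le beta1 L2 (ltW q0) qM N0 size)) // expr2; lra.
(* As [s <= 2], this makes [theta * tau <= 1/16], as the tail bound asks, and [2 theta tau <= 1/2],
   as the centering asks. *)
pose theta := s / (32 * tau).
have theta0 : 0 < theta by rewrite divr_gt0 // mulr_gt0.
have thtau : theta * tau = s / 32 by rewrite /theta; field; rewrite gt_eqF.
pose pmax := cmax / (m%:R * n%:R).
have pmax0 : 0 <= pmax by rewrite divr_ge0 // mulr_ge0.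
pose kappa := 2 * (32 * expR 4 * (theta * tau) ^+ 2 * ct) * (pmax * M).
have kappa0 : 0 <= kappa.
  apply: mulr_ge0; last by rewrite mulr_ge0.
  apply: mulr_ge0 => //; apply: mulr_ge0 => //; apply: mulr_ge0 (sqr_ge0 _).
  by apply: mulr_ge0 => //; exact: expR_ge0.
have step i (S : 'M[R]_(m, n)) :
    (\int[P]_w (trace_exp (S - theta *: c0 + (theta * Y i w) *: X i w))%:E <=
     ((1 + kappa) * trace_exp S)%:E)%E.
  apply: (trace_exp_unit_step (X := X i) (xi := xi i) beta1 sigma0 sigtau
    (ltW theta0) _ A0tau (lawX i) Pi1 (indX i) (ixi i) (Exi i) (tailxi i)) => //.
  - by rewrite thtau; lra.
  - exact: leq_maxl.
  - exact: leq_maxr.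
  - have h := frobenius_dilation_le c0.
    have h' := frobenius_weighted_le Pi1 (ltW tau0) A0tau.
    apply: (@le_trans _ _ (theta * (2 * tau))).
      by rewrite ler_wpM2l ?(ltW theta0) // (le_trans h) // ler_wpM2l.
    by rewrite mulrCA thtau; lra.
have mY i : measurable_fun [set: T] (Y i).
  apply: measurable_funD => //; apply: measurable_fun_mxdot => // j k.
  by apply: (measurableT_comp (matrix_entry_measurable j k)).
(* The 16 is what remains of [32^2 / (2 * 32)]; the dimensions cancel through [m n = q M]. *)
pose B := expR 4 * ct * cmax / 16.
have NkB : N%:R * kappa = B * L.
  have mnE : m%:R * n%:R = q * M.
    by rewrite -!natrM mulnC; congr _%:R; rewrite /minn /maxn; case: ltnP => _; rewrite // mulnC.
  have M0 : M != 0 by rewrite gt_eqF // (lt_le_trans q0).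
  rewrite /kappa thtau /pmax mnE expr_div_n sqrE.
  by rewrite /B; field; rewrite M0 !gt_eqF.
(* In the level [(B + 2) L], the part [B L] pays for the growth [(1 + kappa)^N], one [L] for the
   initial trace [m + n = e^L], and the last [L] leaves the probability [1 / (m + n)]. *)
have [E [mE PE Eb]] := bilinear_concentration
  (fun i => measurable_funPT (X i)) mY indXY kappa0 step ((B + 2) * L).
exists E; split => //.
  apply: le_trans PE; rewrite lee_fin lerB //.
  have k1 : (1 + kappa) ^+ N <= expR (B * L).
    rewrite -NkB mulrC expRM_natr; apply: lerXn2r; rewrite ?nnegrE ?addr_ge0 ?expR_ge0 //.
    exact: expR_ge1Dx.
  have e : expR L = (m + n)%:R by rewrite lnK ?posrE.
  rewrite mulrDl opprD expRD -mulrA; apply: (@le_trans _ _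
    (expR (- (B * L)) * (expR (- (2 * L)) * (expR (B * L) * (m + n)%:R)))).
    by rewrite !ler_wpM2l ?expR_ge0 // ler_wpM2r.
  rewrite -e mulrCA mulrA; rewrite -[in leLHS]mulrA -!expRD -expRN ler_expR; lra.
move=> w /Eb h u v u1 v1; have {h} := h u v u1 v1.
rewrite big_split /= sumrN sumr_const card_ord.
have -> : N%:R^-1 *: (\sum_i Y i w *: X i w) - c0 =
    N%:R^-1 *: (\sum_i Y i w *: X i w - c0 *+ N).
  by rewrite scalerBr -(scaler_nat N c0) scalerA mulVf ?gt_eqF // scale1r.
rewrite mxdotZl -/B -/L -/q; set x := mxdot _ _ => h.
rewrite ler_pdivrMl //.
have sE : Num.sqrt (L / (q * N%:R)) = s / q.
  have -> : L / (q * N%:R) = (q * L / N%:R) / q ^+ 2.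
    by field; rewrite !gt_eqF.
  rewrite sqrtrM // sqrtrV ?sqr_ge0 //.
  by rewrite sqrtr_sqr gtr0_norm.
rewrite -(ler_pM2l theta0); apply: le_trans h _.
rewrite sE; have -> : theta * (N%:R * (32 * (B + 2) * tau * (s / q))) =
    (B + 2) * (s ^+ 2 * N%:R / q).
  by rewrite /theta; field; rewrite !gt_eqF.
rewrite sqrE.
rewrite le_eqVlt; apply/orP; left; apply/eqP; field; rewrite !gt_eqF //.
Qed.

End NoiseEvent.

Theorem corollary1 (R : realType)
    (alpha beta ctilde cbar c1 c1' : R)
    (halpha : 1 < alpha) (hbeta : 1 <= beta) (hcbar : 0 < cbar)
    (hc1 : 0 < c1) (hc1' : c1 <= c1') :
  exists2 C0 : R, 0 < C0 & forall C : R, C0 <= C ->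
  exists2 C' : R, 0 < C' &
  forall (m1 m2 n r : nat) (sigma a : R)
    (A0 : 'M[R]_(m1, m2)) (Pi : probability 'M[R]_(m1, m2) R)
    (d : measure_display) (T : measurableType d) (P : probability T R)
    (X : 'I_n -> {RV P >-> 'M[R]_(m1, m2)})
    (xi : 'I_n -> {RV P >-> R}) (Y : 'I_n -> T -> R)
    (Ahat : T -> 'M[R]_(m1, m2)),
  let m := (m1 + m2)%N in
  let M := maxn m1 m2 in
  let lambda := C * Num.max sigma a *
    Num.sqrt (ln m%:R / ((minn m1 m2)%:R * n%:R)) in
  (0 < m1)%N -> (0 < m2)%N ->
  (* the model *)
  (forall i w, Y i w = \tr ((X i w)^T *m A0) + xi i w) ->
  mutually_independent P
    (fun i w => (X i w, Y i w) : ('M[R]_(m1, m2) * R)%type) ->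
  mutually_independent P (fun i => xi i : T -> R) ->
  identically_distributed P (fun i => xi i : T -> R) ->
  (forall i, P.-integrable [set: T] (EFin \o xi i)) ->
  (forall i, ('E_P[xi i] = 0)%E) ->
  (forall i, ('V_P[xi i] < +oo)%E) ->
  mutually_independent P (fun i => X i : T -> 'M[R]_(m1, m2)) ->
  (forall i, has_law P (X i) Pi) ->
  Pi (matrix_units R m1 m2) = 1%E ->
  (forall i, independent2 P (X i) (xi i)) ->
  (* the assumptions *)
  (1 <= r)%N -> (\rank A0 <= r)%N ->
  coherence Pi <= kappa1 Pi ^+ 2 / (11 * alpha * r%:R) ->
  0 < sigma ->
  (forall i, ('E_P[(fun w => expR (`|xi i w| `^ beta / sigma `^ beta))%R]
     < ctilde%:E)%E) ->
  (forall i, ((cbar * sigma ^+ 2)%R%:E <= 'E_P[(fun w => xi i w ^+ 2)%R])%E) ->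
  Num.sqrt (c1 / (m1%:R * m2%:R)) <= kappa1 Pi ->
  kappa1 Pi <= kappa1' Pi ->
  kappa1' Pi <= Num.sqrt (c1' / (m1%:R * m2%:R)) ->
  2 * c1' <= M%:R * c1 ->
  (forall i j, `|A0 i j| <= a) ->
  M%:R * ln m%:R `^ (1 + 2 / beta) < n%:R ->
  (* the estimator *)
  (forall w, is_argmin
     (objective Pi (fun i => X i w) (fun i => Y i w) lambda) (Ahat w)) ->
  ((1 - m%:R^-1)%R%:E <=
   P [set w | (spectral_norm (Ahat w - A0) <=
        C' * Num.max sigma a * Num.sqrt (m1%:R * m2%:R) *
        Num.sqrt (M%:R * ln m%:R / n%:R))%R])%E.
Proof.
pose B : R := expR 4 * `|ctilde| * c1' / 16.
have c1'0 : 0 < c1' by exact: lt_le_trans hc1'.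
have B0 : 0 <= B by rewrite /B divr_ge0 // mulr_ge0 ?(ltW c1'0) // mulr_ge0 // expR_ge0.
(* Four times the constant 32 of the noise bound, so that the noise stays below [lambda / 4]. *)
exists (128 * (B + 2)) => [|C CB]; first by lra.
have C0 : 0 < C by apply: lt_le_trans CB; lra.
(* From the deterministic bound [6 lambda / kappa1^2] and [kappa1^2 >= c1 / (m1 m2)]. *)
exists (6 * C / c1) => [|m1 m2 n r sigma a A0 Pi d T P X xi Y Ahat m M lambda m10 m20].
  by rewrite divr_gt0 // mulr_gt0.
move=> model indXY _ _ ixi Exi _ _ lawX Pi1 indX r1 rkA0 coh sigma0 tailxi _ kap kk kap'.
move=> _ A0a size amin.
have YE : Y = fun i w => mxdot (X i w) A0 + xi i w.
  by apply/funext => i; apply/funext => w; exact: model.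
clear model; subst Y.
have m1R : 0 < m1%:R :> R by rewrite ltr0n.
have m2R : 0 < m2%:R :> R by rewrite ltr0n.
have rR : 0 < r%:R :> R by rewrite ltr0n.
have nR : 0 < n%:R :> R by apply: le_lt_trans size; rewrite mulr_ge0 // powR_ge0.
pose tau := Num.max sigma a; pose L : R := ln m%:R; pose q : R := (minn m1 m2)%:R.
have tau0 : 0 < tau by rewrite lt_max sigma0.
have A0tau j k : `|A0 j k| <= tau by rewrite (le_trans (A0a j k)) // le_max lexx orbT.
have L0 : 0 < L.
  by rewrite (lt_le_trans _ (half_le_ln _ _)) // /m -[2%N]/(1 + 1)%N leq_add.
have q0 : 0 < q by rewrite ltr0n leq_min m10.
have lam0 : 0 < lambda.
  by rewrite !mulr_gt0 // sqrtr_gt0 divr_gt0 // mulr_gt0.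
have c1m : 0 < c1 / (m1%:R * m2%:R) by rewrite divr_gt0 // mulr_gt0.
have kap0 : 0 < kappa1 Pi by rewrite (lt_le_trans _ kap) // sqrtr_gt0.
have kap2 : c1 / (m1%:R * m2%:R) <= kappa1 Pi ^+ 2.
  rewrite -(sqr_sqrtr (ltW c1m)); apply: lerXn2r => //; rewrite nnegrE ?sqrtr_ge0 //.
  exact: ltW.
pose w := unit_weights Pi.
have wk j k : kappa1 Pi ^+ 2 <= w j k by apply: kappa1_le_weights => //; exact: ltW.
have wmax j k : w j k <= c1' / (m1%:R * m2%:R).
  by apply: weights_le_kappa1' => //; rewrite divr_ge0 ?mulr_ge0 // ltW.
have kap20 : 0 < kappa1 Pi ^+ 2 by rewrite exprn_gt0.
pose c0 : 'M[R]_(m1, m2) := \matrix_(j, k) (w j k * A0 j k).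
pose N t := n%:R^-1 *: (\sum_i (mxdot (X i t) A0 + xi i t) *: X i t) - c0.
(* Completing the square: [c0] is the mean of [Y_i X_i], and its pairing with [A] is
   [wdot w A0 A]. *)
have objE t A : objective Pi (fun i => X i t) (fun i => mxdot (X i t) A0 + xi i t) lambda A =
    penalized w lambda A0 (N t) A - wdot w A0 A0.
  rewrite /objective /penalized /l2norm l2dot_unit_design // -/w sqr_sqrtr; last first.
    rewrite (le_trans _ (wdot_ge A wk)) // mulr_ge0 ?mxdot_ge0 //; exact: ltW.
  rewrite /N -[X in _ - mxdot X _]scalerA !mxdotZl mxdotBl -/w.
  rewrite -[mxdot c0 A]wdotE !(wdotDl, wdotDr, wdotNl, wdotNr) (wdotC _ A A0) mxdotZl; ring.
have {}amin t : is_argmin (penalized w lambda A0 (N t)) (Ahat t).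
  by move=> A; have := amin t A; rewrite !objE lerD2r.
have sigtau : sigma <= tau by rewrite le_max lexx.
have Exi' i : (\int[P]_t (xi i t)%:E = 0)%E by rewrite -(Exi i) unlock.
have tail' i : (\int[P]_t (expR (`|xi i t| `^ beta / sigma `^ beta))%:E <= `|ctilde|%:E)%E.
  have := tailxi i; rewrite unlock => /ltW/le_trans; apply.
  by rewrite lee_fin ler_norm.
have [E [mE PE Eb]] := noise_event m10 m20 hbeta sigma0 sigtau
  (normr_ge0 ctilde) (ltW c1'0) A0tau lawX Pi1 indX ixi Exi' tail' wmax indXY size.
pose S := [set t | spectral_norm (Ahat t - A0) <= 6 * C / c1 * tau *
  Num.sqrt (m1%:R * m2%:R) * Num.sqrt (M%:R * L / n%:R)].
rewrite -/S.
have mS : measurable S.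
  apply: (measurable_argmin_event _ kap20 lam0 wk _ amin) => j k.
  under eq_fun do rewrite mxE [X in X + _]mxE summxE.
  apply: measurable_funD; last exact: measurable_cst.
  apply: measurable_funM; first exact: measurable_cst.
  apply: measurable_sum => i; under eq_fun do rewrite mxE.
  have mX l l' : measurable_fun [set: T] (fun t => X i t l l').
    exact: (measurableT_comp (matrix_entry_measurable l l') (measurable_funPT (X i))).
  apply: measurable_funM => //; apply: measurable_funD => //.
  by apply: measurable_fun_mxdot => // l l'; exact: measurable_cst.
apply: le_trans PE _; apply: le_measure; rewrite ?inE // => t /Eb Et.
have rate : 32 * (B + 2) * tau * Num.sqrt (L / (q * n%:R)) <= lambda / 4.
  rewrite ler_pdivlMr // /lambda -/tau -/L -/q mulrAC.
  by rewrite ler_wpM2r ?sqrtr_ge0 // mulrAC ler_wpM2r ?(ltW tau0) //; lra.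
have Nle D : mxdot (N t) D <= lambda / 4 * nuclear_norm D.
  apply: mxdot_le_nuclear; first by rewrite divr_gt0.
  apply: spectral_norm_le_bilinear; first by rewrite divr_ge0 // ltW.
  by move=> u v u1 v1; exact: le_trans (Et u v u1 v1) rate.
have cohw D1 D2 : mxdot D1 D2 = 0 ->
    `|wdot w D1 D2| <= kappa1 Pi ^+ 2 / (11 * r%:R) * (nuclear_norm D1 * nuclear_norm D2).
  move=> /(wdot_le_coherence Pi1)/le_trans; apply.
  rewrite ler_wpM2r ?mulr_ge0 ?nuclear_norm_ge0 // (le_trans coh) //.
  rewrite ler_wpM2l ?(ltW kap20) // lef_pV2 ?posrE ?mulr_gt0 //; last exact: lt_trans halpha.
  by rewrite ler_wpM2r ?(ltW rR) // ler_peMr // ltW.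
have rkr : (\rank A0)%:R <= r%:R :> R by rewrite ler_nat.
have bound := penalized_bilinear_bound kap20 lam0 wk rkr rR cohw Nle (amin t).
(* The product of the dimensions is their minimum times their maximum, which trades the minimum in
   [lambda] for the maximum in the final rate. *)
have lamE : m1%:R * m2%:R * Num.sqrt (L / (q * n%:R)) =
    Num.sqrt (m1%:R * m2%:R) * Num.sqrt (M%:R * L / n%:R).
  have mnE : m1%:R * m2%:R = q * M%:R.
    by rewrite -!natrM; congr _%:R; rewrite /M /minn /maxn; case: ltnP => _; rewrite // mulnC.
  have MR : 0 < M%:R :> R by rewrite ltr0n leq_max m10.
  have mn0 : 0 <= q * M%:R by rewrite mulr_ge0 // ltW.
  rewrite mnE -sqrtrM //.
  have -> : q * M%:R * (M%:R * L / n%:R) = (q * M%:R) ^+ 2 * (L / (q * n%:R)).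
    by field; rewrite !gt_eqF.
  by rewrite [RHS]sqrtrM ?sqr_ge0 // sqrtr_sqr ger0_norm.
have lamle : 6 * lambda / kappa1 Pi ^+ 2 <= 6 * C / c1 * tau *
    Num.sqrt (m1%:R * m2%:R) * Num.sqrt (M%:R * L / n%:R).
  rewrite -[leRHS]mulrA -lamE ler_pdivrMr //.
  apply: (@le_trans _ _ (6 * C / c1 * tau * (m1%:R * m2%:R * Num.sqrt (L / (q * n%:R))) *
    (c1 / (m1%:R * m2%:R)))).
    rewrite le_eqVlt /lambda -/tau -/L -/q; apply/orP; left; apply/eqP; field.
    by rewrite !gt_eqF.
  rewrite ler_wpM2l // !mulr_ge0 ?sqrtr_ge0 ?invr_ge0 ?(ltW c1m) ?(ltW C0) ?(ltW hc1) ?(ltW tau0) ?(ltW m1R) //.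
apply: spectral_norm_le_unit => [|u v u1 v1].
  by apply: le_trans lamle; rewrite divr_ge0 ?mulr_ge0 ?(ltW lam0) // ltW.
exact: le_trans (bound u v u1 v1) lamle.
Qed.
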